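(* Let $I\subseteq[d]$ be nonempty and set $k:=|I|$. Let $f\in BV(S)$ be a probability density on $S$, and let $\varphi\in W^{1,\infty}(S)$ be centered on $I$. Then $$|\mathbb E_f[\varphi]|\le\frac1{2k}\,\Lambda_{\mathrm{sl}}^I(\varphi)\,\mathrm{TV}_I(f;S).$$ Consequently, $$|\mathbb E_f[\varphi]|\le\frac1{2k}\,\Lambda_{\mathrm{sl}}^I(\varphi)\,\mathrm{TV}_\infty(f;S).$$ If $\|\varphi\|_{L^\infty(S)}\le h$, then $$|\mathbb E_f[\varphi]|\le\frac{h}{2k}\Bigl(\max_{i\in I}(b_i-a_i)\Bigr)\mathrm{TV}_I(f;S).$$
   Context: Let $d\ge 1$, $[d]=\{1,\dots,d\}$, and let $S=\prod_{i=1}^d[a_i,b_i]\subset\mathbb R^d$ be a box with $a_i<b_i$. For $i\in[d]$ write $\omega_{-i}=(\omega_j)_{j\ne i}$ and $S_{-i}=\prod_{j\ne i}[a_j,b_j]$; $\varphi(\omega_{-i},t)$ means that $t$ is inserted in the $i$th coordinate. A probability density on $S$ is a nonnegative integrable function with integral $1$, and $\mathbb E_f[\varphi]=\int_S\varphi f\,d\omega$. A function $\varphi\in L^1(S)$ is centered on $I$ if for every $i\in I$ one has $\int_{a_i}^{b_i}\varphi(\omega_{-i},t)\,dt=0$ for a.e. $\omega_{-i}\in S_{-i}$. The coordinate-slice envelope is $$\Lambda_{\mathrm{sl}}^I(\varphi)=\max_{i\in I}\operatorname*{ess\,sup}_{\omega_{-i}\in S_{-i}}\int_{a_i}^{b_i}|\varphi(\omega_{-i},t)|\,dt.$$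 For $f\in BV(S)$, $D_if$ is the $i$th distributional derivative measure of $f$ on the interior of $S$ (no boundary jumps are counted), $|D_if|(S)$ denotes its total variation mass on the interior of $S$, and $$\mathrm{TV}_I(f;S)=\sum_{i\in I}|D_if|(S),\qquad \mathrm{TV}_\infty(f;S)=\sum_{i=1}^d|D_if|(S).$$ *)

(* Defs.v *)
From HB Require Import structures.
From mathcomp Require Import all_boot all_order all_algebra.
From mathcomp Require Import all_classical all_reals all_analysis.
From mathcomp Require Import ess_sup_inf.

Set Implicit Arguments.
Unset Strict Implicit.
Unset Printing Implicit Defensive.

Import Order.TTheory GRing.Theory Num.Theory.
Import numFieldNormedType.Exports.

Local Open Scope classical_set_scope.
Local Open Scope ring_scope.

Definition measure_rV_display : measure_display.
Proof. exact: default_measure_display. Qed.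

(** [R^d] is ['rV[R]_d], with the library's norm, topology and directional
    derivatives.  The sigma-algebra below is the product one, generated by the
    coordinates; it coincides with the Borel sigma-algebra. *)

Section measurable_rV.
Context {R : realType} (d : nat).

Definition rV_coord (i : 'I_d) (w : 'rV[R]_d) : R := w 0 i.

HB.instance Definition _ := @isMeasurable.Build measure_rV_display
  'rV[R]_d (g_sigma_preimage rV_coord) (@sigma_algebra0 _ _ _)
  (@sigma_algebraC _ _) (@sigma_algebra_bigcup _ _ _).

End measurable_rV.

Section measurable_coord.
Context {R : realType}.

Lemma measurable_rV_coord d (i : 'I_d) :
  measurable_fun [set: 'rV[R]_d] (@rV_coord R d i).
Proof.
move=> _ Y mY; rewrite setTI; apply: sub_sigma_algebra => /=.
rewrite -bigcup_seq/=; exists i => /=; first by rewrite mem_index_enum.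
by exists Y => //; rewrite setTI.
Qed.

Lemma measurable_fun_rV d1 (T : measurableType d1) d (f : T -> 'rV[R]_d) :
  (forall i, measurable_fun [set: T] (fun x => f x 0 i)) ->
  measurable_fun [set: T] f.
Proof.
move=> mf.
suff sub : g_sigma_preimage (fun i => @rV_coord R d i \o f) `<=` measurable.
  rewrite g_sigma_preimage_comp in sub.
  by move=> _ A mA; apply: sub; exists A.
apply: smallest_sub; first exact: sigma_algebra_measurable.
move=> A; rewrite -bigcup_seq => -[i _ [B mB <-]].
exact: mf.
Qed.

End measurable_coord.

(** [rV_insert i t w] is [(w, t)], with [t] inserted as the [i]th coordinate;
    its left inverse, which drops the [i]th coordinate, is [col' i]. *)
Definition rV_insert {R : realType} {d : nat} (i : 'I_d) (t : R)
    (w : 'rV[R]_d.-1) : 'rV[R]_d :=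
  \row_j (if unlift i j is Some k then w 0 k else t).

Section lebesgue_rV_step.
Context {R : realType} (n : nat).
Variable mu : {sigma_finite_measure set 'rV[R]_n -> \bar R}.
Local Open Scope ereal_scope.

Let ins (p : R * 'rV[R]_n) : 'rV[R]_n.+1 := rV_insert ord0 p.1 p.2.
Let del (w : 'rV[R]_n.+1) : R * 'rV[R]_n := (w ord0 ord0, col' ord0 w).

Let measurable_ins : measurable_fun setT ins.
Proof.
apply: measurable_fun_rV => j.
case: (unliftP ord0 j) => [k ->|->].
  rewrite (_ : (fun x => _) = @rV_coord R n k \o snd).
    by apply: measurableT_comp => //; exact: measurable_rV_coord.
  by apply/funext => p; rewrite /= mxE liftK.
rewrite (_ : (fun x => _) = fst) //.
by apply/funext => p; rewrite /= mxE unlift_none.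
Qed.

Let measurable_del : measurable_fun setT del.
Proof.
apply/measurable_fun_pairP; split => /=; first exact: measurable_rV_coord.
apply: measurable_fun_rV => j.
rewrite (_ : (fun x => _) = @rV_coord R n.+1 (lift ord0 j)).
  exact: measurable_rV_coord.
by apply/funext => w; rewrite /= mxE.
Qed.

Definition lebesgue_rV_step : set 'rV[R]_n.+1 -> \bar R :=
  pushforward (lebesgue_measure \x mu) ins.

HB.instance Definition _ := Measure.copy lebesgue_rV_step
  (measure_function_pushforward__canonical__measure_function_Measure
     (lebesgue_measure \x mu) measurable_ins).

Let insK : cancel ins del.
Proof.
move=> [t w]; rewrite /del /ins /=; congr (_, _); first by rewrite mxE unlift_none.
by apply/rowP => k; rewrite !mxE liftK.
Qed.

Let step_sigma_finite : sigma_finite setT lebesgue_rV_step.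
Proof.
have /sigma_finiteP[F [TF ndF Foo]] := sigma_finiteT (@lebesgue_measure R).
have /sigma_finiteP[G [TG ndG Goo]] := sigma_finiteT mu.
exists (fun k => del @^-1` (F k `*` G k)).
  rewrite -preimage_bigcup (_ : \bigcup_k _ = setT) ?preimage_setT//.
  rewrite -subTset => -[t w] _.
  have [n1 _ Fn] : (\bigcup_k F k) t by rewrite -TF.
  have [n2 _ Gn] : (\bigcup_k G k) w by rewrite -TG.
  exists (maxn n1 n2) => //; split.
  - by move: Fn; exact/subsetPset/ndF/leq_maxl.
  - by move: Gn; exact/subsetPset/ndG/leq_maxr.
move=> k; have [mF Fk] := Foo k; have [mG Gk] := Goo k; split.
  rewrite -[X in measurable X]setTI.
  by apply: measurable_del => //; exact: measurableX.
rewrite /lebesgue_rV_step /pushforward -comp_preimage.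
rewrite (_ : del \o ins = id); last by apply/funext => p /=; rewrite insK.
by rewrite preimage_id product_measure1E// lte_mul_pinfty// ge0_fin_numE.
Qed.

HB.instance Definition _ := Measure_isSigmaFinite.Build _ _ _
  lebesgue_rV_step step_sigma_finite.

End lebesgue_rV_step.

(** Iterated product of the one-dimensional Lebesgue measure.  Dimension 0 occurs
    as the space of [S_{-i}] when [d = 1]. *)
Fixpoint lebesgue_rV {R : realType} (d : nat) :
    {sigma_finite_measure set 'rV[R]_d -> \bar R} :=
  match d return {sigma_finite_measure set 'rV[R]_d -> \bar R} with
  | 0%N => \d_(0 : 'rV[R]_0)
  | n.+1 => lebesgue_rV_step (lebesgue_rV n)
  end.

Section box.
Context {R : realType} (d : nat).
Implicit Types a b : 'rV[R]_d.

(** The box [S] with corners [a] and [b].  For [i : 'I_d], the lower-dimensional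
    box [S_{-i}] is [box (col' i a) (col' i b)]. *)
Definition box a b : set 'rV[R]_d := [set w | forall i, a 0 i <= w 0 i <= b 0 i].

Lemma measurable_box a b : measurable (box a b).
Proof.
rewrite (_ : box a b = \bigcap_(i in [set: 'I_d]) rV_coord i @^-1` `[a 0 i, b 0 i]).
  apply: fin_bigcap_measurable => // i _.
  by rewrite -[X in measurable X]setTI; exact: measurable_rV_coord.
apply/seteqP; split=> [w /= wab i _|w /= wab i].
  by rewrite /= in_itv /=; exact: wab.
by move: (wab i Logic.I); rewrite /= in_itv.
Qed.

Definition lebesgue_box a b : {measure set 'rV[R]_d -> \bar R} :=
  mrestr (lebesgue_rV d) (measurable_box a b).

End box.

Lemma lebesgue_rV_box (R : realType) (d : nat) (a b : 'rV[R]_d) : (forall i, a 0 i <= b 0 i) ->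
  lebesgue_rV d (box a b) = (\prod_(i < d) (b 0 i - a 0 i))%:E.
Proof.
elim: d a b => [|n IH] a b ab.
  by rewrite big_ord0 /= diracE mem_set// => -[].
rewrite big_ord_recl /= /lebesgue_rV_step /pushforward.
rewrite (_ : _ @^-1` _ =
  `[a 0 ord0, b 0 ord0] `*` box (col' ord0 a) (col' ord0 b)).
  rewrite product_measure1E//; last exact: measurable_box.
  rewrite IH; last by move=> i; rewrite !mxE.
  have E : lebesgue_measure (`[a 0 ord0, b 0 ord0] : set R) =
      (b 0 ord0 - a 0 ord0)%:E :> \bar R.
    rewrite lebesgue_measure_itv /= lte_fin.
    have := ab ord0; rewrite le_eqVlt => /orP[/eqP <-|->].
      by rewrite ltxx subrr.
    by rewrite -EFinD.
  rewrite (eq_bigr (fun i => b 0 (lift ord0 i) - a 0 (lift ord0 i))); last first.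
    by move=> i _; rewrite !mxE.
  by rewrite EFinM; congr (_ * _)%E; exact: E.
apply/seteqP; split => -[t w] /=.
  move=> H; split.
    by move: (H ord0); rewrite mxE unlift_none in_itv.
  by move=> i; move: (H (lift ord0 i)); rewrite !mxE liftK.
move=> [H1 H2] i; rewrite mxE; case: (unliftP ord0 i) => [k ->|->] /=.
  by move: (H2 k); rewrite !mxE.
by move: H1; rewrite in_itv.
Qed.

Section test_function.
Context {R : realType} {d : nat}.
Implicit Types (g : 'rV[R]_d -> R) (U : set 'rV[R]_d).

Definition partial (i : 'I_d) g : 'rV[R]_d -> R := 'D_(delta_mx 0 i) g.

Definition iter_partial (s : seq 'I_d) g : 'rV[R]_d -> R := foldr partial g s.

(** [C^oo] through iterated partial derivatives: all of them, in every order,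
    exist everywhere and are continuous. *)
Definition smooth g := forall s : seq 'I_d,
  continuous (iter_partial s g) /\
  forall (i : 'I_d) x, derivable (iter_partial s g) x (delta_mx 0 i).

Definition tsupport g : set 'rV[R]_d := closure [set x | g x != 0].

Definition test_function U g :=
  [/\ smooth g, compact (tsupport g) & tsupport g `<=` U].

End test_function.

Section signed_measure.
Context d (T : measurableType d) (R : realType).
Variable nu : {charge set T -> \bar R}.
Local Open Scope ereal_scope.

Definition hahn_pos : set T := sval (cid (Hahn_decomposition nu)).

Definition hahn_neg : set T := sval (cid (svalP (cid (Hahn_decomposition nu)))).

Definition hahn_posneg : hahn_decomposition nu hahn_pos hahn_neg :=
  svalP (cid (svalP (cid (Hahn_decomposition nu)))).

Definition variation : set T -> \bar R := charge_variation hahn_posneg.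

(** Integral against a signed measure, through its Jordan decomposition. *)
Definition charge_integral (U : set T) (g : T -> R) : \bar R :=
  \int[jordan_pos hahn_posneg]_(x in U) (g x)%:E -
  \int[jordan_neg hahn_posneg]_(x in U) (g x)%:E.

End signed_measure.

Section function_spaces.
Context {R : realType} {d : nat} (a b : 'rV[R]_d).
Implicit Types f g phi : 'rV[R]_d -> R.
Local Open Scope ereal_scope.

Local Notation S := (box a b).
Local Notation leb := (lebesgue_rV d).

Definition Linfty_norm phi : \bar R := 'N[lebesgue_box a b]_+oo [EFin \o phi].

Definition Linfty phi := measurable_fun S phi /\ Linfty_norm phi < +oo.

(** [g] is the [i]th weak derivative of [phi] on the interior of [S]. *)
Definition weak_partial (i : 'I_d) phi g :=
  forall eta, test_function S° eta ->
    \int[leb]_(w in S°) (phi w * partial i eta w)%:E =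
    - \int[leb]_(w in S°) (g w * eta w)%:E.

Definition W1infty phi :=
  Linfty phi /\ forall i, exists2 g, Linfty g & weak_partial i phi g.

(** [nu] is [D_i f] on the interior of [S]: only the values of [nu] on
    subsets of the interior matter. *)
Definition distr_partial (i : 'I_d) f (nu : {charge set 'rV[R]_d -> \bar R}) :=
  forall eta, test_function S° eta ->
    \int[leb]_(w in S°) (f w * partial i eta w)%:E = - charge_integral nu S° eta.

Definition BV f := leb.-integrable S (EFin \o f) /\
  forall i, exists nu : {charge set 'rV[R]_d -> \bar R}, distr_partial i f nu.

(** [|D_i f|(S)], with value [+oo] if [D_i f] is not a finite signed measure.
    The choice of [nu] is immaterial, as [D_i f] is determined by [f] on the
    interior of [S]. *)
Definition partial_variation (i : 'I_d) f : \bar R :=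
  match pselect (exists nu, distr_partial i f nu) with
  | left ex_nu => variation (sval (cid ex_nu)) S°
  | right _ => +oo
  end.

Definition TV (I : {set 'I_d}) f : \bar R := \sum_(i in I) partial_variation i f.

Definition TV_infty f : \bar R := \sum_(i < d) partial_variation i f.

(** As for the elements of [BV], densities are functions up to a.e. equality. *)
Definition probability_density f :=
  [/\ leb.-integrable S (EFin \o f),
      {ae lebesgue_box a b, forall w, (0 <= f w)%R} &
      \int[leb]_(w in S) (f w)%:E = 1].

Definition expectation_density f phi : \bar R :=
  \int[leb]_(w in S) (phi w * f w)%:E.

Definition centered_on (I : {set 'I_d}) phi := forall i, i \in I ->
  {ae lebesgue_box (col' i a) (col' i b), forall w,
    \int[lebesgue_measure]_(t in `[a ord0 i, b ord0 i])
      (phi (rV_insert i t w))%:E = 0}.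

Definition slice_envelope (I : {set 'I_d}) phi : \bar R :=
  \big[maxe/-oo]_(i in I) ess_sup (lebesgue_box (col' i a) (col' i b))
    (fun w => \int[lebesgue_measure]_(t in `[a ord0 i, b ord0 i])
                `|phi (rV_insert i t w)|%:E).

End function_spaces.

(* Main.v *)
Require Import Defs.
From HB Require Import structures.
From mathcomp Require Import all_boot all_order all_algebra.
From mathcomp Require Import all_classical all_reals all_analysis.
From mathcomp Require Import measurable_realfun ess_sup_inf.
From mathcomp Require Import ring lra.

(** For a single coordinate [i] the estimate is an integration by parts.  Let
    [F(x)] be the integral of [phi] along the [i]th coordinate from [a_i] to
    [x_i].  It vanishes on the two faces [x_i = a_i] and [x_i = b_i] because
    [phi] is centered, and [|F|] is at most half of the slice integral of
    [|phi|], since the part of the slice below [x_i] and the part above it have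
    opposite integrals.  As [phi] is the [i]th partial derivative of [F],
    [E_f[phi] = - \int F d(D_i f)], so [|E_f[phi]|] is at most half of the
    slice envelope times [|D_i f|(S)].  Averaging over [i] in [I] gives the
    factor [1/(2k)].

    The distributional derivative only speaks of smooth compactly supported
    functions, and [F] is neither.  The formula is extended by a monotone class
    argument instead of a mollification: for bounded measurable [g], let
    [ibp_defect g] be the error in the formula for [g] minus its slice mean.
    This functional is linear and continuous under bounded pointwise
    convergence, so by [bp_linear_eq0] it vanishes as soon as it does on the
    constant [1] and on the indicators of the sets [ray e], a pi-system that
    generates the sigma-algebra.  Intersected with the open box, such a set is a
    product of intervals, and its indicator is a bounded limit of tensor
    products of smooth bumps.  Once corrected to have zero mean along the
    slices, these satisfy the formula by the very definition of [D_i f]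
    ([ibp_defect_tensor], [ibp_defect_ray]).

    As [phi] is controlled only almost everywhere, it is first set to zero on
    the null set where it exceeds its essential bound and on the null family of
    slices where it is not centered or has too large an absolute integral
    ([coordinate_bound]); Fubini's theorem in the form [lebesgue_rV_insert]
    shows that this changes no integral. *)

Set Implicit Arguments.
Unset Strict Implicit.
Unset Printing Implicit Defensive.

Import Order.TTheory GRing.Theory Num.Theory.
Import numFieldNormedType.Exports.

Local Open Scope classical_set_scope.
Local Open Scope ring_scope.

(** * Smooth functions of one variable *)

Section flat.
Context {R : realType}.
Implicit Types (p : {poly R}) (x y : R).

(** The factor [p(1/x)] makes the family closed under differentiation, so that a
    single computation shows that all its members are smooth. *)
Definition flat p x : R := if 0 < x then p.[x^-1] * expR (- x^-1) else 0.

(** Multiplying by an arbitrary power of [x] makes the claim inductive in [p];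
    the monomials are bounded by one term of the exponential series. *)
Lemma poly_expR_bounded p :
  exists C, forall x, 0 < x -> `|p.[x]| * expR (- x) <= C.
Proof.
suff : forall n, exists C, forall x, 0 < x ->
    `|p.[x]| * x ^+ n * expR (- x) <= C.
  move=> /(_ 0%N)[C pC]; exists C => x x0.
  by have := pC x x0; rewrite expr0 mulr1.
elim/poly_ind: p => [n|p c ih n].
  by exists 0 => x x0; rewrite horner0 normr0 !mul0r.
have [C pC] := ih n.+1.
exists (C + `|c| * n.+1`!%:R * 2) => x x0; rewrite !hornerE.
have e0 := expR_gt0 (- x).
apply: (@le_trans _ _ (`|p.[x]| * x ^+ n.+1 * expR (- x) +
    `|c| * (x ^+ n * expR (- x)))).
  rewrite exprS !mulrA -mulrDl ler_wpM2r//.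
  rewrite -mulrDl ler_wpM2r ?exprn_ge0//; first exact: ltW.
  by rewrite (le_trans (ler_normD _ _))// normrM (gtr0_norm x0).
rewrite lerD ?pC// -mulrA ler_wpM2l// expRN ler_pdivrMr ?expR_gt0//.
case: n {ih pC} => [|n].
  rewrite expr0 -[leLHS]mulr1 ler_pM//; first by rewrite mul1r ler1n.
  by rewrite -expR0 ler_expR ltW.
have h := expR_ge1Dxn n (ltW x0).
have f1 : 0 < n.+1`!%:R :> R by rewrite ltr0n fact_gt0.
apply: (@le_trans _ _ (n.+1`!%:R * expR x)).
  rewrite mulrC -ler_pdivrMr//; apply: le_trans h.
  by rewrite lerDr.
rewrite ler_wpM2r ?expR_ge0// (@le_trans _ _ (n.+2`!%:R))//.
  by rewrite ler_nat leq_fact.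
by rewrite ler_peMr// ler1n.
Qed.

(** At the origin, [|flat p h| <= C * h ^ 2] follows from the boundedness of
    [x ^ 2 * p(x) * e ^ (- x)]. *)
Lemma is_derive_flat p x :
  is_derive x 1 (flat p) (flat ('X^2 * (p - p^`())) x).
Proof.
have [x0|x0|<-] := ltgtP 0 x; last first.
- rewrite {2}/flat ltxx.
  have [C pC] := poly_expR_bounded ('X^2 * p).
  have C0 : 0 <= C by apply: le_trans (pC 1 ltr01); rewrite mulr_ge0 ?expR_ge0.
  have fC h : `|flat p h| <= C * `|h| ^+ 2.
    rewrite /flat; case: ifPn => h0; last by rewrite normr0 mulr_ge0 ?exprn_ge0.
    have := pC h^-1; rewrite invr_gt0 => /(_ h0).
    rewrite hornerM hornerXn normrM normrX gtr0_norm ?invr_gt0//.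
    rewrite normrM (gtr0_norm h0) (gtr0_norm (expR_gt0 _)) exprVn -mulrA.
    by rewrite mulrC ler_pdivrMr// exprn_gt0.
  suff H : h^-1 *: (flat p (h *: (1:R) + 0) - flat p 0) @[h --> 0^'] --> (0:R).
    by split; [exact: (cvgP _ H)|exact: cvg_lim].
  apply/cvgr0Pnorm_lt => e e0; near=> h.
  rewrite addr0 [h *: 1]mulr1 {2}/flat ltxx subr0 [_ *: _]mulrC normrM.
  have h0 : h != 0 by near: h; exact: nbhs_dnbhs_neq.
  apply: (@le_lt_trans _ _ (C * `|h|)).
    by rewrite normfV ler_pdivrMr ?normr_gt0// -mulrA -expr2.
  apply: (@le_lt_trans _ _ ((C + 1) * `|h|)).
    by rewrite ler_wpM2r// lerDl.
  rewrite -ltr_pdivlMl ?ltr_wpDl// mulrC; near: h.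
  apply: dnbhs0_lt; rewrite divr_gt0// ltr_wpDl//.
- apply: (@near_eq_is_derive _ _ _ (cst 0)).
    by near=> z; rewrite /flat/= ltNge ltW//; near: z; exact: lt_nbhsl.
  by rewrite /flat ltNge (ltW x0)/=; exact: is_derive_cst.
- apply: (@near_eq_is_derive _ _ _
      ((horner p \o (fun y => y^-1)) * (expR \o (fun y => - y^-1)))).
    near=> z; rewrite /flat /= ifT//; near: z; exact: lt_nbhsr.
  have dV : is_derive x 1 (fun y : R => y^-1) (- x ^- 2 *: 1).
    by apply: is_deriveV; rewrite ?gt_eqF.
  apply: is_derive_eq.
  rewrite /flat x0 /= !hornerE /GRing.scale/= ?exprVn.
  by rewrite !expr2; field; rewrite gt_eqF.
Unshelve. all: by end_near. Qed.

Lemma flat1_ge0 x : 0 <= flat 1 x.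
Proof. by rewrite /flat; case: ifP => // _; rewrite hornerE mul1r expR_ge0. Qed.

Lemma flat1_gt0 x : 0 < x -> 0 < flat 1 x.
Proof. by rewrite /flat => ->; rewrite hornerE mul1r expR_gt0. Qed.

Lemma flat1_le1 x : flat 1 x <= 1.
Proof.
rewrite /flat; case: ifPn => // x0; rewrite hornerE mul1r -expR0 ler_expR.
by rewrite oppr_le0 invr_ge0 ltW.
Qed.

Lemma flat1_homo : {homo flat 1 : x y / x <= y}.
Proof.
move=> x y xy; have [x0|x0] := leP x 0.
  by rewrite {1}/flat ltNge x0 flat1_ge0.
have y0 : 0 < y by exact: lt_le_trans xy.
by rewrite /flat x0 y0 !hornerE ler_expR lerN2 lef_pV2.
Qed.

Lemma flat_le0 p x : x <= 0 -> flat p x = 0.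
Proof. by move=> x0; rewrite /flat ltNge x0. Qed.

End flat.

(** Smoothness is by construction: the class contains the flat functions that
    give compact supports, and each of its members has its derivative in the
    class ([smooth1_derive]).  The constructor [smooth1_prim] admits the
    antiderivatives from which test functions are built. *)
Inductive smooth1 {R : realType} : (R -> R) -> Prop :=
| smooth1_flat p (s c : R) : smooth1 (fun x => flat p (s * x + c))
| smooth1_cst c : smooth1 (cst c)
| smooth1D u v : smooth1 u -> smooth1 v -> smooth1 (u \+ v)
| smooth1M u v : smooth1 u -> smooth1 v -> smooth1 (u \* v)
| smooth1_prim u v : (forall x : R, is_derive x 1 u (v x)) ->
    smooth1 v -> smooth1 u.

Section smooth1_theory.
Context {R : realType}.
Implicit Types (u v : R -> R).

Lemma smooth1_derive u : smooth1 u ->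
  exists2 v : R -> R, smooth1 v & forall x : R, is_derive x 1 u (v x).
Proof.
elim=> {u} [p s c|c|u v su [u' su' du] sv [v' sv' dv]|
  u v su [u' su' du] sv [v' sv' dv]|u v du sv _]; last by exists v.
- exists ((fun x => flat ('X^2 * (p - p^`())) (s * x + c)) \* cst s).
    by apply: smooth1M; [exact: smooth1_flat|exact: smooth1_cst].
  move=> x; apply: (@is_derive1_comp _ (flat p) (fun x => s * x + c)).
    exact: is_derive_flat.
  apply: is_derive_eq.
  by rewrite addr0 [_ *: _]mulr1.
- exists (cst 0); first exact: smooth1_cst.
  by move=> x; exact: is_derive_cst.
- exists (u' \+ v'); first exact: smooth1D.
  by move=> x; exact: is_deriveD.
- exists ((u \* v') \+ (v \* u')); first by apply: smooth1D; exact: smooth1M.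
  by move=> x; exact: is_deriveM.
Qed.

Lemma smooth1_continuous u : smooth1 u -> continuous u.
Proof.
move=> /smooth1_derive[v _ du] x.
by apply: differentiable_continuous; apply/derivable1_diffP; case: (du x).
Qed.

Lemma smooth1_measurable u : smooth1 u -> measurable_fun setT u.
Proof. by move=> su; apply: continuous_measurable_fun; exact: smooth1_continuous. Qed.

Lemma smooth1X u n : smooth1 u -> smooth1 (fun x => u x ^+ n).
Proof.
move=> su; elim: n => [|n ih].
  by under eq_fun do rewrite expr0; exact: smooth1_cst.
by under eq_fun do rewrite exprS; exact: smooth1M.
Qed.

Lemma smooth1Z u c : smooth1 u -> smooth1 (fun x => c * u x).
Proof. by apply: smooth1M; exact: smooth1_cst. Qed.

Lemma smooth1B u v : smooth1 u -> smooth1 v -> smooth1 (u \- v).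
Proof.
move=> su sv; rewrite [X in smooth1 X](_ : _ = u \+ (fun x => -1 * v x)).
  by apply: smooth1D => //; exact: smooth1Z.
by apply/funext => x /=; rewrite mulN1r.
Qed.

End smooth1_theory.

Section smooth_bump.
Context {R : realType}.
Implicit Types (c d x : R) (n : nat).

(** Supported in [[c + 1/(n+1), d - 1/(n+1)]]; it increases with [n], so at a
    point of [ ]c, d[ ] it stays above a positive constant for large [n]. *)
Definition smooth_bump_core c d n x : R :=
  flat 1 (x - c - n.+1%:R^-1) * flat 1 (d - x - n.+1%:R^-1).

(** The power drives every positive value of the core to [1] and keeps the value
    [0]: with polynomials only, this gives smooth functions with values in
    [[0, 1]] that converge pointwise to the indicator of [ ]c, d[ ]. *)
Definition smooth_bump c d n x : R := 1 - (1 - smooth_bump_core c d n x) ^+ n.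

Lemma smooth_bump_core_itv c d n x : 0 <= smooth_bump_core c d n x <= 1.
Proof.
by rewrite mulr_ge0 ?flat1_ge0// mulr_ile1 ?flat1_ge0 ?flat1_le1.
Qed.

Lemma smooth1_bump c d n : smooth1 (smooth_bump c d n).
Proof.
apply: smooth1B; first exact: smooth1_cst.
apply: smooth1X; apply: smooth1B; first exact: smooth1_cst.
apply: smooth1M.
  rewrite (_ : (fun x => _) = (fun x => flat 1 (1 * x + (- c - n.+1%:R^-1)))).
    exact: smooth1_flat.
  by apply/funext => x; rewrite mul1r addrA.
rewrite (_ : (fun x => _) = (fun x => flat 1 ((-1) * x + (d - n.+1%:R^-1)))).
  exact: smooth1_flat.
by apply/funext => x; congr flat; ring.
Qed.

Lemma smooth_bump_itv c d n x : 0 <= smooth_bump c d n x <= 1.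
Proof.
have /andP[b0 b1] := smooth_bump_core_itv c d n x.
rewrite /smooth_bump subr_ge0 exprn_ile1 ?subr_ge0 ?gerBl//=.
by rewrite exprn_ge0// subr_ge0.
Qed.

Lemma smooth_bump_out c d n x : ~~ (c + n.+1%:R^-1 <= x <= d - n.+1%:R^-1) ->
  smooth_bump c d n x = 0.
Proof.
move=> xcd; rewrite /smooth_bump /smooth_bump_core.
suff -> : flat 1 (x - c - n.+1%:R^-1) * flat 1 (d - x - n.+1%:R^-1) = 0.
  by rewrite subr0 expr1n subrr.
move: xcd; set e := n.+1%:R^-1; rewrite negb_and -!ltNge => /orP[h|h].
  by rewrite flat_le0 ?mul0r//; lra.
by rewrite [X in _ * X]flat_le0 ?mulr0//; lra.
Qed.

Lemma smooth_bump_cvg c d x :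
  smooth_bump c d n x @[n --> \oo] --> (\1_(`]c, d[%classic) x : R).
Proof.
rewrite indicE; have [/set_mem|xcd] := boolP (x \in _); last first.
  rewrite (_ : (fun n => _) = cst 0); first exact: cvg_cst.
  apply/funext => n; apply: smooth_bump_out; apply: contra xcd => /andP[cx xd].
  have n0 : 0 < n.+1%:R^-1 :> R by rewrite invr_gt0.
  set e := _^-1 in n0 cx xd; rewrite inE /= in_itv/=; apply/andP; split; lra.
rewrite /= in_itv/= => /andP[cx xd].
have [N HN] : exists N : nat, N.+1%:R^-1 < Num.min (x - c) (d - x).
  have m0 : 0 < Num.min (x - c) (d - x) by rewrite lt_min !subr_gt0 cx.
  near \oo => N; exists N; near: N; exact: (near_infty_natSinv_lt (PosNum m0)).
move: HN; rewrite lt_min => /andP[]; set e := N.+1%:R^-1 => N1 N2.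
pose q := smooth_bump_core c d N x.
have q0 : 0 < q by rewrite /q /smooth_bump_core -/e mulr_gt0 ?flat1_gt0//; lra.
have q1 : q <= 1 by have /andP[] := smooth_bump_core_itv c d N x.
rewrite /=; suff Y : (1 - smooth_bump_core c d n x) ^+ n @[n --> \oo] --> (0 : R).
  by rewrite -[X in _ --> X]subr0; apply: cvgB Y; exact: cvg_cst.
apply: (@squeeze_cvgr _ _ _ _ (cst 0) (fun n => (1 - q) ^+ n)).
- near=> n.
  have /andP[b0 b1] := smooth_bump_core_itv c d n x.
  rewrite exprn_ge0 ?subr_ge0//= lerXn2r ?nnegrE ?subr_ge0//.
  rewrite lerD2l lerN2.
  have nN : n.+1%:R^-1 <= e.
    rewrite lef_pV2 ?posrE// ler_nat ltnS; near: n; exact: nbhs_infty_ge.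
  rewrite /q /smooth_bump_core -/e; set e' := n.+1%:R^-1 in nN *.
  by rewrite ler_pM ?flat1_ge0//; apply: flat1_homo; lra.
- exact: cvg_cst.
- by apply: cvg_expr; rewrite ger0_norm ?subr_ge0// ltrBlDr ltrDl.
Unshelve. all: by end_near. Qed.

End smooth_bump.

Lemma eq_Rintegral_support d (T : measurableType d) (R : realType)
    (mu : {measure set T -> \bar R}) (D E : set T) (v : T -> R) :
  (forall x, v x != 0 -> D x <-> E x) ->
  \int[mu]_(x in D) v x = \int[mu]_(x in E) v x.
Proof.
move=> DE; rewrite Rintegral_mkcond [RHS]Rintegral_mkcond.
apply: eq_Rintegral => x _; rewrite !patchE.
have [->|vx] := eqVneq (v x) 0; first by rewrite !if_same.
by rewrite (_ : (x \in D) = (x \in E))//; apply/idP/idP;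
  rewrite !inE => /(DE _ vx).
Qed.

Section primitive.
Context {R : realType}.
Notation leb := (@lebesgue_measure R).
Variables (v : R -> R) (al a b be : R).
Hypotheses (ala : al < a) (bbe : b < be) (sv : smooth1 v).
Hypothesis supp_v : forall x, ~~ (a <= x <= b) -> v x = 0.

Let int_v D : measurable D -> leb.-integrable D (EFin \o v).
Proof.
move=> mD; apply: integrableS (measurableT) mD (@subsetT _ _) _.
rewrite (_ : EFin \o v = (EFin \o v) \_ `[a, b]); last first.
  apply/funext => x; rewrite patchE; case: ifPn => // xab /=.
  by rewrite supp_v//; apply: contra xab => xab; rewrite inE /= in_itv.
apply/(integrable_mkcond _ _).1; first exact: measurable_itv.
apply: continuous_compact_integrable; first exact: segment_compact.
exact/continuous_subspaceT/smooth1_continuous.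
Qed.

(** Integrating from [-oo] makes the antiderivative differentiable at every
    point; the zero mean makes it vanish to the right of the support too. *)
Lemma smooth1_zero_mean_primitive :
  \int[leb]_(x in `]al, be[) v x = 0 ->
  exists2 U : R -> R, smooth1 U & [/\ forall x : R, is_derive x 1 U (v x),
    forall x, ~~ (a <= x <= b) -> U x = 0 &
    forall t, al < t -> U t = \int[leb]_(x in `]al, t]) v x].
Proof.
move=> v0; pose U t := \int[leb]_(x in `]-oo, t]) v x.
have suppv x : v x != 0 -> a <= x <= b.
  by apply: contraNT => /supp_v ->.
have dU (x : R) : is_derive x 1 U (v x).
  have [] := @continuous_FTC1 _ v -oo%O x (x + 1).
  - by rewrite ltrDl.
  - by apply: int_v; exact: measurable_itv.
  - by rewrite ltNyr.
  - exact: smooth1_continuous.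
  by move=> dU; rewrite derive1E; exact: DeriveDef.
exists U; first exact: (smooth1_prim dU).
split => // [x xab|t alt].
  have [xa|ax] := ltP x a.
    rewrite /U (@eq_Rintegral_support _ _ _ _ _ set0) ?Rintegral_set0//.
    by move=> y /suppv; rewrite /= in_itv/= => ?; split => //; lra.
  have bx : b < x by move: xab; rewrite ax -ltNge.
  rewrite -v0 /U; apply: eq_Rintegral_support; move=> /= y.
  move: (y : R) => {}y /suppv.
  rewrite !in_itv/= => /andP[ay yb]; split=> _; last exact/ltW/(le_lt_trans yb).
  by rewrite (lt_le_trans ala)//= (le_lt_trans yb).
rewrite /U; apply: eq_Rintegral_support => /= y.
move: (y : R) => {}y /suppv; rewrite /= !in_itv/= => /andP[ay yb]; split=> [yt|/andP[]//].
by rewrite (lt_le_trans ala).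
Qed.

End primitive.

(** * Lebesgue measure on [R^d] and Fubini along any coordinate *)

Section insert.
Context {R : realType} (n : nat) (i : 'I_n.+1).
Implicit Types (t : R) (w : 'rV[R]_n).

Lemma rV_insert_eq t w : rV_insert i t w 0 i = t.
Proof. by rewrite mxE unlift_none. Qed.

Lemma rV_insert_lift t w k : rV_insert i t w 0 (lift i k) = w 0 k.
Proof. by rewrite mxE liftK. Qed.

Lemma col'_insert t w : col' i (rV_insert i t w) = w.
Proof. by apply/rowP => k; rewrite mxE rV_insert_lift. Qed.

Lemma measurable_rV_insert :
  measurable_fun setT (fun p : R * 'rV[R]_n => rV_insert i p.1 p.2).
Proof.
apply: measurable_fun_rV => j; case: (unliftP i j) => [k ->|->].
  under eq_fun do rewrite rV_insert_lift.
  exact: (measurableT_comp (measurable_rV_coord k) measurable_snd).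
under eq_fun do rewrite rV_insert_eq.
exact: measurable_fst.
Qed.

Lemma measurable_col' : measurable_fun setT (fun x : 'rV[R]_n.+1 => col' i x).
Proof.
apply: measurable_fun_rV => j; under eq_fun do rewrite mxE.
exact: measurable_rV_coord.
Qed.

End insert.

Section rect.
Context {R : realType}.

Definition rect d (A : 'I_d -> set R) : set 'rV[R]_d :=
  [set w | forall l, A l (w 0 l)].

Lemma measurable_rect d (A : 'I_d -> set R) :
  (forall l, measurable (A l)) -> measurable (rect A).
Proof.
move=> mA; rewrite (_ : rect A = \bigcap_(l in [set: 'I_d]) (rV_coord l @^-1` A l)).
  apply: fin_bigcap_measurable => // l _.
  by rewrite -[X in measurable X]setTI; exact: measurable_rV_coord.
by apply/seteqP; split=> [w wA l _|w wA l]; [exact: wA|exact: (wA l Logic.I)].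
Qed.

Lemma insert_rect n (i : 'I_n.+1) (A : 'I_n.+1 -> set R) :
  (fun p => rV_insert i p.1 p.2) @^-1` rect A = A i `*` rect (A \o lift i).
Proof.
apply/seteqP; split => -[t w] /=.
  move=> H; split; first by have := H i; rewrite rV_insert_eq.
  by move=> k; have := H (lift i k); rewrite rV_insert_lift.
move=> [ti H] j; case: (unliftP i j) => [k ->|->]; last by rewrite rV_insert_eq.
by rewrite rV_insert_lift; exact: H.
Qed.

Lemma lebesgue_rV_rect d (A : 'I_d -> set R) :
  (forall l, measurable (A l)) ->
  lebesgue_rV d (rect A) = (\prod_(l < d) lebesgue_measure (A l))%E.
Proof.
elim: d A => [|n ih] A mA.
  by rewrite big_ord0 /= diracE mem_set// => -[].
rewrite big_ord_recl /= /lebesgue_rV_step /pushforward insert_rect.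
rewrite product_measure1E; [|exact: mA|by apply: measurable_rect => l; exact: mA].
by rewrite ih// => l; exact: mA.
Qed.

Lemma measurable_rV_rect d :
  @measurable _ 'rV[R]_d =
  <<s [set rect A | A in [set A : 'I_d -> set R | forall l, measurable (A l)]] >>.
Proof.
apply/seteqP; split; last first.
  apply: smallest_sub; first exact: sigma_algebra_measurable.
  by move=> _ [A mA <-]; exact: measurable_rect.
apply: smallest_sub; first exact: smallest_sigma_algebra.
move=> A; rewrite -bigcup_seq => -[l _ [B mB <-]]; apply: sub_sigma_algebra.
exists (fun k => if k == l then B else setT).
  by move=> k /=; case: ifP.
apply/seteqP; split=> [w /(_ l)|w [_ Bw] k] /=; first by rewrite eqxx.
by case: eqP => [->|].
Qed.

Lemma rect_setI_closed d :
  setI_closed [set rect A | A in [set A : 'I_d -> set R | forall l, measurable (A l)]].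
Proof.
move=> _ _ [A mA <-] [B mB <-]; exists (fun l => A l `&` B l).
  by move=> l; apply: measurableI; [exact: mA|exact: mB].
by apply/seteqP; split=> [w AB|w [wA wB] l]; split; first [exact: wA|exact: wB|
  move=> l; by have [] := AB l].
Qed.

End rect.

Section fubini.
Context {R : realType} (n : nat) (i : 'I_n.+1).
Local Open Scope ereal_scope.
Notation leb := (@lebesgue_measure R).
Let ins (p : R * 'rV[R]_n) := rV_insert i p.1 p.2.

(** The iterated product singles out the first coordinate.  Both measures give
    a product of measurable sets the product of their lengths, so the singled
    out coordinate may be any [i]. *)
Lemma lebesgue_rV_insert (A : set 'rV[R]_n.+1) : measurable A ->
  lebesgue_rV n.+1 A = (leb \x lebesgue_rV n) (ins @^-1` A).
Proof.
pose nu := pushforward (leb \x lebesgue_rV n) ins.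
rewrite -[RHS]/(nu A); move: A.
apply: (measure_unique [set rect A | A in
    [set A : 'I_n.+1 -> set R | forall l, measurable (A l)]]
  (fun k => rect (fun=> `[(- k%:R)%R, k%:R]%classic))).
- exact: measurable_rV_rect.
- exact: rect_setI_closed.
- by move=> k; exists (fun=> `[(- k%:R)%R, k%:R]%classic).
- rewrite -subTset => w _.
  have [k wk] : exists k : nat, forall l, (`|w ord0 l| <= k%:R)%R.
    exists (\max_(l < n.+1) (Num.truncn `|w ord0 l|).+1)%N => l.
    apply: (@le_trans _ _ ((Num.truncn `|w ord0 l|).+1%:R)).
      exact/ltW/truncnS_gt.
    by rewrite ler_nat; exact: leq_bigmax.
  by exists k => // l /=; rewrite in_itv/= -ler_norml.
- exact: measurable_rV_insert.
- move=> mins _ [A mA <-].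
  transitivity (\prod_(l < n.+1) leb (A l)); first exact: lebesgue_rV_rect.
  rewrite /nu /= /pushforward insert_rect product_measure1E; [|exact: mA|by
    apply: measurable_rect => l; exact: mA].
  rewrite lebesgue_rV_rect; last by move=> l; exact: mA.
  by rewrite (bigD1_ord i).
- move=> k; rewrite [ltLHS](_ : _ =
    \prod_(l < n.+1) leb `[(- k%:R)%R, k%:R]%classic); last first.
    exact: lebesgue_rV_rect.
  have [r ->] : exists r : R, leb `[(- k%:R)%R, k%:R]%classic = r%:E.
    by rewrite lebesgue_measure_itv /=; case: ifP => _; eexists.
  by rewrite prodEFin ltry.
Qed.

Lemma lebesgue_rV_col' (N : set 'rV[R]_n) : measurable N ->
  lebesgue_rV n N = 0 -> lebesgue_rV n.+1 [set x | N (col' i x)] = 0.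
Proof.
move=> mN N0; rewrite lebesgue_rV_insert; last first.
  by rewrite -[X in measurable X]setTI; exact: measurable_col'.
rewrite (_ : _ @^-1` _ = setT `*` N).
  by rewrite product_measure1E// N0 mule0.
by apply/seteqP; split => -[t w] /=; rewrite col'_insert//; case.
Qed.

Lemma lebesgue_rV_slice_null (Z : set 'rV[R]_n.+1) : measurable Z ->
  lebesgue_rV n.+1 Z = 0 ->
  {ae lebesgue_rV n, forall w, leb [set t | Z (rV_insert i t w)] = 0}.
Proof.
move=> mZ; rewrite lebesgue_rV_insert//.
have mP : measurable (ins @^-1` Z).
  by rewrite -[X in measurable X]setTI; exact: measurable_rV_insert.
rewrite (@product_measure_unique _ _ _ _ _ leb (lebesgue_rV n)
  (leb \x^ lebesgue_rV n))//; last by move=> *; exact: product_measure2E.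
rewrite /= /product_measure2 => Z0.
have mf := @measurable_fun_ysection _ _ _ _ _ leb _ mP.
have /ae_eq_integral_abs : \int[lebesgue_rV n]_w `|(leb \o ysection (ins @^-1` Z)) w| = 0.
  by rewrite -Z0; apply: eq_integral => w _; rewrite gee0_abs.
move=> /(_ measurableT mf); apply: filterS => w /(_ Logic.I) /= <-; congr (leb _).
by apply/seteqP; split => t; rewrite /ysection /= inE.
Qed.

End fubini.

(** * A functional monotone class theorem *)

Section bounded_measurable.
Context {d} {T : measurableType d} {R : realType}.
Implicit Types (g h : T -> R) (M : R).

Definition bdd_measurable M g := measurable_fun setT g /\ forall x, `|g x| <= M.

Lemma bdd_measurableDZ M N g h c : bdd_measurable M g -> bdd_measurable N h ->
  bdd_measurable (M + `|c| * N) (fun x => g x + c * h x).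
Proof.
move=> [mg gM] [mh hN]; split.
  by apply: measurable_funD => //; exact: measurable_funM.
move=> x; rewrite (le_trans (ler_normD _ _))// lerD// normrM.
by rewrite ler_wpM2l.
Qed.

Lemma bdd_measurableM M N g h : bdd_measurable M g -> bdd_measurable N h ->
  bdd_measurable (M * N) (g \* h).
Proof.
move=> [mg gM] [mh hN]; split; first exact: measurable_funM.
by move=> x; rewrite normrM ler_pM.
Qed.

Lemma bdd_measurable_cst c : bdd_measurable `|c| (cst c).
Proof. by split => //; exact: measurable_cst. Qed.

Lemma bdd_measurable_indic (A : set T) : measurable A -> bdd_measurable 1 \1_A.
Proof.
move=> mA; split; first exact: measurable_indic.
by move=> x; rewrite indicE; case: (_ \in _); rewrite ?normr1 ?normr0.
Qed.

Lemma bdd_measurable_lim M (g_ : (T -> R)^nat) g : (forall n, bdd_measurable M (g_ n)) ->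
  (forall x, g_ n x @[n --> \oo] --> g x) -> bdd_measurable M g.
Proof.
move=> bg gx; split.
  apply: (measurable_fun_cvg (h := g_)); first by move=> n; have [] := bg n.
  by move=> x _; exact: gx.
move=> x; rewrite -(cvg_lim _ (cvg_norm (gx x)))//.
apply: limr_le; first by apply: cvgP (cvg_norm (gx x)).
by apply: nearW => n; have [_] := bg n.
Qed.

End bounded_measurable.

(** The functionals to which monotone class arguments apply: linear on bounded
    measurable functions and continuous under bounded pointwise convergence
    (hence the prefix [bp]). *)
Definition bp_linear d (T : measurableType d) (R : realType) (L : (T -> R) -> R) :=
  (forall M N g h c, bdd_measurable M g -> bdd_measurable N h ->
    L (fun x => g x + c * h x) = L g + c * L h) /\
  (forall M (g_ : (T -> R)^nat) g, (forall n, bdd_measurable M (g_ n)) ->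
    (forall x, g_ n x @[n --> \oo] --> g x) -> L (g_ n) @[n --> \oo] --> L g).

Import HBSimple HBNNSimple.

Section bp_linear_eq0.
Context {d} {T : measurableType d} {R : realType}.
Variable L : (T -> R) -> R.
Hypothesis bpL : bp_linear L.

Lemma bp_linear0 : L (cst 0) = 0.
Proof.
have b0 : bdd_measurable 0 (cst 0 : T -> R) by
  split=> [|x]; [exact: measurable_cst|rewrite normr0].
have := bpL.1 _ _ _ _ (-1) b0 b0; rewrite mulN1r subrr.
rewrite (_ : (fun x => _) = cst 0)//.
by apply/funext => x /=; rewrite mulr0 addr0.
Qed.

Lemma bp_linear_lim_eq0 M (g_ : (T -> R)^nat) g : (forall n, bdd_measurable M (g_ n)) ->
    (forall x, g_ n x @[n --> \oo] --> g x) -> (forall n, L (g_ n) = 0) ->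
  L g = 0.
Proof.
move=> bg gx Lg; have := bpL.2 _ _ _ bg gx.
rewrite (_ : (fun n => _) = cst 0); last by apply/funext => n; rewrite Lg.
by move/(cvg_unique (@Rhausdorff R) (cvg_cst 0)) => /esym.
Qed.

Lemma bp_linear_sum_eq0 n (c : 'I_n -> R) (A : 'I_n -> set T) :
  (forall k, measurable (A k)) -> (forall k, L \1_(A k) = 0) ->
  L (fun x => \sum_(k < n) c k * \1_(A k) x) = 0.
Proof.
move=> mA LA; suff [] : L (fun x => \sum_(k < n) c k * \1_(A k) x) = 0 /\
  exists M, bdd_measurable M (fun x => \sum_(k < n) c k * \1_(A k) x) by [].
elim: n c A mA LA => [|n ih] c A mA LA.
  under eq_fun do rewrite big_ord0.
  by split; [exact: bp_linear0|exists `|0 : R|; exact: bdd_measurable_cst].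
under eq_fun do rewrite big_ord_recr/=.
have [|//|L0 [M bM]] := ih (c \o widen_ord (leqnSn n)) (A \o widen_ord (leqnSn n)).
  by move=> k; exact: mA.
  by move=> k; exact: LA.
split.
  by rewrite (bpL.1 _ _ _ _ _ bM (bdd_measurable_indic (mA _))) L0 LA mulr0 addr0.
by eexists; exact: (bdd_measurableDZ _ bM (bdd_measurable_indic (mA _))).
Qed.

Variable G : set (set T).
Hypotheses (TG : @measurable _ T = <<s G>>) (GI : setI_closed G).
Hypotheses (L1 : L (cst 1) = 0) (LG : forall A, G A -> L \1_A = 0).

Let L_indic A : measurable A -> L \1_A = 0.
Proof.
rewrite TG; move: A; apply: (@dynkin_induction _ _ G) => //.
- by rewrite indicT.
- move=> A mA LA.
  have -> : \1_(~` A) = (fun x => cst 1 x + (-1) * \1_A x) :> (T -> R).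
    by apply/funext => x; rewrite !indicE in_setC; case: (_ \in _) => /=; ring.
  by rewrite (bpL.1 _ _ _ _ _ (bdd_measurable_cst 1) (bdd_measurable_indic mA))
    L1 LA mulr0 addr0.
- move=> F mF tF LF.
  apply: (@bp_linear_lim_eq0 1 (fun n => \1_(\big[setU/set0]_(k < n) F k))).
  + by move=> n; apply: bdd_measurable_indic; exact: bigsetU_measurable.
  + move=> x; rewrite [X in _ --> X]indicE.
    have [/set_mem[k _ Fkx]|xF] := boolP (x \in _).
      apply: cvg_near_cst; exists k.+1 => // m /= km.
      by rewrite indicE mem_set// -bigcup_mkord; exists k.
    apply: cvg_near_cst; apply: nearW => m; rewrite indicE memNset//.
    rewrite -bigcup_mkord => -[k _ Fkx]; move/negP: xF; apply.
    by rewrite inE; exists k.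
  + elim=> [|n ih]; first by rewrite big_ord0 indic0; exact: bp_linear0.
    rewrite big_ord_recr/=.
    have -> : \1_(\big[setU/set0]_(k < n) F k `|` F n) =
        (fun x => \1_(\big[setU/set0]_(k < n) F k) x + 1 * \1_(F n) x) :> (T -> R).
      apply/funext => x; rewrite mul1r !indicE in_setU.
      have [/set_mem xF|] := boolP (x \in \big[setU/set0]_(k < n) F k);
        have [/set_mem xn|] := boolP (x \in F n); rewrite /= ?addr0 ?add0r//.
      move: xF; rewrite -bigcup_mkord => -[k /= kn xk].
      move/trivIsetP : tF => /(_ k n Logic.I Logic.I); rewrite ltn_eqF// => /(_ isT).
      by move/seteqP => [/(_ x)] /=; case.
    rewrite (bpL.1 _ _ _ _ _ (bdd_measurable_indic _) (bdd_measurable_indic (mF n)))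
      ?ih ?LF ?mulr0 ?addr0//.
    exact: bigsetU_measurable.
Qed.

(** The sets whose indicator is annihilated form a Dynkin system, hence contain
    the sigma-algebra; simple functions, their bounded limits and, after adding
    a constant, all bounded functions follow. *)
Lemma bp_linear_eq0 M g : bdd_measurable M g -> L g = 0.
Proof.
move=> bg; have [mg gM] := bg.
suff H : forall N h, bdd_measurable N h -> (forall x, 0 <= h x) -> L h = 0.
  have bh := bdd_measurableDZ M bg (bdd_measurable_cst 1).
  have -> : g = (fun x => (fun x => g x + M * cst 1 x) x + (- M) * cst 1 x).
    by apply/funext => x /=; ring.
  rewrite (bpL.1 _ _ _ _ _ bh (bdd_measurable_cst 1)) L1 mulr0 addr0.
  apply: H bh _ => x /=; rewrite mulr1.
  by have := gM x; rewrite ler_norml => /andP[]; lra.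
move=> N h [mh hN] h0.
have mEh : measurable_fun setT (EFin \o h) by exact/measurable_EFinP.
pose f_ := nnsfun_approx measurableT mEh.
have ndf := nd_nnsfun_approx measurableT mEh.
have f_h x : f_ n x @[n --> \oo] --> h x.
  by have /fine_cvgP[] :=
    cvg_nnsfun_approx measurableT mEh (fun x _ => h0 x) (x := x) Logic.I.
apply: (@bp_linear_lim_eq0 N f_) => // n.
  split => // x; rewrite ger0_norm//.
  apply: le_trans (hN x); apply: le_trans (ler_norm _).
  rewrite -(cvg_lim _ (f_h x))//; apply: nondecreasing_cvgn_le.
    by move=> m k /ndf /lefP.
  exact: cvgP (f_h x).
have /funext -> := fimfunEord (f_ n).
apply: bp_linear_sum_eq0 => k //.
by apply: L_indic.
Qed.

End bp_linear_eq0.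

Section bp_operator.
Context {d} {T : measurableType d} {R : realType}.
Implicit Types (L : (T -> R) -> R) (K : (T -> R) -> T -> R).

(** The operators that can be composed with a [bp_linear] functional.  Here
    convergence is pointwise, so linearity is stated pointwise too. *)
Definition bp_operator K := [/\
  forall M, exists N, forall g, bdd_measurable M g -> bdd_measurable N (K g),
  forall M N g h c, bdd_measurable M g -> bdd_measurable N h ->
    forall x, K (fun x => g x + c * h x) x = K g x + c * K h x &
  forall M (g_ : (T -> R)^nat) g, (forall n, bdd_measurable M (g_ n)) ->
    (forall x, g_ n x @[n --> \oo] --> g x) ->
    forall x, K (g_ n) x @[n --> \oo] --> K g x].

Lemma bp_operator_id : bp_operator id.
Proof. by split => // M; exists M. Qed.

Lemma bp_operatorB K K' : bp_operator K -> bp_operator K' ->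
  bp_operator (fun g x => K g x - K' g x).
Proof.
move=> [bK lK cK] [bK' lK' cK']; split.
- move=> M; have [N HN] := bK M; have [N' HN'] := bK' M.
  exists (N + `|-1| * N') => g bg.
  have := bdd_measurableDZ (-1) (HN _ bg) (HN' _ bg).
  by under eq_fun do rewrite mulN1r.
- move=> M N g h c bg bh x.
  by rewrite (lK _ _ _ _ _ bg bh) (lK' _ _ _ _ _ bg bh); ring.
- by move=> M g_ g bg gx x; apply: cvgB; [exact: cK|exact: cK'].
Qed.

Lemma bp_linear_comp L K : bp_linear L -> bp_operator K -> bp_linear (L \o K).
Proof.
move=> [lL cL] [bK lK cK]; split.
- move=> M N g h c bg bh /=.
  have [M' HM] := bK M; have [N' HN] := bK N.
  rewrite -(lL _ _ _ _ _ (HM _ bg) (HN _ bh)); congr L.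
  by apply/funext => x; exact: lK bg bh x.
- move=> M g_ g bg gx; have [M' HM] := bK M.
  by apply: (cL M') => [n|x]; [exact: HM|exact: (cK M)].
Qed.

Lemma bp_linearDZ L L' c : bp_linear L -> bp_linear L' ->
  bp_linear (fun g => L g + c * L' g).
Proof.
move=> [lL cL] [lL' cL']; split.
- move=> M N g h e bg bh.
  by rewrite (lL _ _ _ _ _ bg bh) (lL' _ _ _ _ _ bg bh); ring.
- move=> M g_ g bg gx; apply: cvgD; first exact: (cL M).
  by apply: cvgMl_tmp; exact: (cL' M).
Qed.

Lemma integrable_bdd_measurable (mu : {measure set T -> \bar R}) (D : set T)
    (f : T -> R) M g :
  measurable D -> mu.-integrable D (EFin \o f) -> bdd_measurable M g ->
  mu.-integrable D (EFin \o (fun x => f x * g x)).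
Proof.
move=> mD fi [mg gM].
rewrite (_ : _ \o _ = (EFin \o f) \* (EFin \o g))%E; last first.
  by apply/funext => x; rewrite /= EFinM.
apply: integrableMl => //; first exact: measurable_funTS.
exists M; split; first exact: num_real.
by move=> N MN x Dx; exact: le_trans (gM x) (ltW MN).
Qed.

Lemma Rintegral_bp_linear (mu : {measure set T -> \bar R}) (D : set T) (f : T -> R) :
  measurable D -> mu.-integrable D (EFin \o f) ->
  bp_linear (fun g => \int[mu]_(x in D) (f x * g x)).
Proof.
move=> mD fi; split.
- move=> M N g h c bg bh.
  have ig := integrable_bdd_measurable mD fi bg.
  have ih := integrable_bdd_measurable mD fi bh.
  rewrite -RintegralZl// -RintegralD//; last first.
    by apply: eq_integrable (integrableZl mD c ih).
  by apply: eq_Rintegral => x _; ring.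
- move=> M g_ g bg gx.
  have bg' := bdd_measurable_lim bg gx.
  have [] := @dominated_convergence _ _ _ mu D mD
    (fun n x => (f x * g_ n x)%:E) (fun x => (f x * g x)%:E)
    (fun x => (`|f x| * M)%:E).
  + by move=> n; apply: measurable_int (integrable_bdd_measurable mD fi (bg n)).
  + exact: measurable_int (integrable_bdd_measurable mD fi bg').
  + apply: aeW => x _; apply: cvg_EFin; first exact: nearW.
    by apply: cvgMl_tmp; exact: gx.
  + exact: (integrableZr mD M (integrable_norm fi)).
  + apply: aeW => x n _; rewrite lee_fin normrM ler_wpM2l//.
    by have [_] := bg n.
  move=> ig _ H; rewrite /Rintegral; apply: fine_cvg.
  by rewrite fineK//; exact: integrable_fin_num.
Qed.

End bp_operator.

(** * Integral operators along slices *)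

(** Tonelli's theorem on the positive and negative parts gives measurability
    without any integrability. *)
Lemma measurable_fun_Rintegral d1 d2 (T1 : measurableType d1) (T2 : measurableType d2)
    (R : realType) (m : {sigma_finite_measure set T1 -> \bar R}) (D : set T1)
    (h : T1 * T2 -> R) : measurable D -> measurable_fun setT h ->
  measurable_fun setT (fun y => \int[m]_(s in D) h (s, y)).
Proof.
move=> mD mh; rewrite /Rintegral.
apply: measurableT_comp; first exact: fine_measurable.
pose h' (p : T1 * T2) := (h p * \1_D p.1)%:E.
have mh' : measurable_fun setT h'.
  apply/measurable_EFinP/measurable_funM => //.
  exact: (measurableT_comp (measurable_indic mD) measurable_fst).
rewrite (_ : (fun y => _) = (fun y => \int[m]_s (h'^\+ (s, y)) - \int[m]_s (h'^\- (s, y)))%E).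
  apply: emeasurable_funB.
  - have mp := measurable_funepos mh'.
    exact: (measurable_fun_fubini_tonelli_G _ mp (funepos_ge0 _)).
  - have mp := measurable_funeneg mh'.
    exact: (measurable_fun_fubini_tonelli_G _ mp (funeneg_ge0 _)).
apply/funext => y.
transitivity (\int[m]_s h' (s, y))%E; last first.
  have := integralE m setT (fun s => h' (s, y)) => ->.
  by congr (_ - _)%E; apply: eq_integral => s _; rewrite ?funeposE ?funenegE.
rewrite integral_mkcond; apply: eq_integral => s _.
rewrite /h' patchE indicE; case: (s \in D); rewrite ?mulr1 ?mulr0//.
Qed.

Section slice_operator.
Context {R : realType} (n : nat) (i : 'I_n.+1) (a b : R).
Notation leb := (@lebesgue_measure R).
Variables (k : R * 'rV[R]_n.+1 -> R) (K : R).
Hypothesis bk : bdd_measurable K k.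

(** Slice means and antiderivatives along slices are both of this form, so their
    boundedness, linearity and continuity are proved once.  The kernel depends
    on the point, in particular on its [i]th coordinate, which [col'] erases. *)
Definition slice_op (g : 'rV[R]_n.+1 -> R) (x : 'rV[R]_n.+1) : R :=
  \int[leb]_(s in `]a, b[) (k (s, x) * g (rV_insert i s (col' i x))).

Lemma bounded_integrable_itv M (h : R -> R) : bdd_measurable M h ->
  leb.-integrable `]a, b[ (EFin \o h).
Proof.
move=> bh; have h1 : leb.-integrable `]a, b[ (EFin \o cst 1).
  apply: measurable_bounded_integrable => //=.
    by rewrite lebesgue_measure_itv/=; case: ifP => _; rewrite ltry.
  by exists 1; split => // N N1 x _ /=; rewrite normr1 ltW.
by apply: eq_integrable (integrable_bdd_measurable _ h1 bh) => // s _; rewrite /= mul1r.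
Qed.

Lemma bdd_measurable_slice M (g : 'rV[R]_n.+1 -> R) (x : 'rV[R]_n.+1) :
  bdd_measurable M g ->
  bdd_measurable M (fun s => g (rV_insert i s (col' i x))).
Proof.
move=> [mg gM]; split => //.
apply: measurableT_comp => //.
exact: (measurableT_comp (measurable_rV_insert i) (pair2_measurable _)).
Qed.

Let bkx x : bdd_measurable K (fun s => k (s, x)).
Proof.
by case: bk => mk kK; split => //; exact: (measurableT_comp mk (pair2_measurable _)).
Qed.

Lemma bp_operator_slice : bp_operator slice_op.
Proof.
have bpx x := @Rintegral_bp_linear _ _ _ leb `]a, b[%classic _ (measurable_itv _)
  (bounded_integrable_itv (bkx x)).
split.
- move=> M; exists (K * M * fine (leb `]a, b[%classic)) => g bg; split.
    apply: (@measurable_fun_Rintegral _ _ _ _ _ leb _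
      (fun p => k p * g (rV_insert i p.1 (col' i p.2)))) => //.
    apply: measurable_funM; first by case: bk.
    apply: measurableT_comp; first by case: bg.
    apply: (measurableT_comp (measurable_rV_insert i)
      (_ : measurable_fun setT (fun p : R * 'rV[R]_n.+1 => (p.1, col' i p.2)))).
    apply/measurable_fun_pairP; split; first exact: measurable_fst.
    exact: (measurableT_comp (measurable_col' i) measurable_snd).
  move=> x; have bkg := bdd_measurableM (bkx x) (bdd_measurable_slice x bg).
  have ikg := bounded_integrable_itv bkg.
  apply: le_trans (le_normr_Rintegral _ ikg) _ => //.
  rewrite -Rintegral_cst//; apply: le_Rintegral => //.
  + exact: integrable_norm.
  + exact: bounded_integrable_itv (bdd_measurable_cst _).
  + by move=> s _; have [_] := bkg.
- move=> M N g h c bg bh x.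
  exact: ((bpx x).1 _ _ _ _ _ (bdd_measurable_slice x bg) (bdd_measurable_slice x bh)).
- move=> M g_ g bg gx x.
  by apply: (bpx x).2 => [m|s]; [exact: bdd_measurable_slice|exact: gx].
Qed.

End slice_operator.

(** * Tensor products as test functions *)

Section smooth_product.
Context {R : realType} {d : nat}.
Implicit Types (w : 'I_d -> R -> R) (x : 'rV[R]_d).

Definition tensor w x : R := \prod_(l < d) w l (x 0 l).

Lemma is_derive_tensor w x i (df : R) : is_derive (x 0 i) (1 : R) (w i) df ->
  is_derive x (delta_mx 0 i : 'rV[R]_d) (tensor w)
    (df * \prod_(l < d | l != i) w l (x 0 l)).
Proof.
move=> [dw wE]; set c := \prod_(_ < _ | _) _.
have H : h^-1 *: (tensor w (h *: delta_mx 0 i + x) - tensor w x) @[h --> 0^'] --> df * c.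
  rewrite (_ : (fun h => _) =
    (fun h => (h^-1 *: (w i (h *: 1 + x 0 i) - w i (x 0 i))) * c)).
    apply: cvgMr_tmp; rewrite -wE; exact: dw.
  apply/funext => h; rewrite /tensor (bigD1 i)//= [in X in _ - X](bigD1 i)//= -/c.
  rewrite (eq_bigr (fun l => w l (x 0 l))) => [|l li]; last first.
    by rewrite !mxE (negbTE li) /= mulr0 add0r.
  by rewrite -/c -mulrBl !mxE !eqxx /= /GRing.scale/= mulrA.
by split; [exact: (cvgP _ H)|exact: cvg_lim].
Qed.

Lemma continuous_tensor w : (forall l, smooth1 (w l)) -> continuous (tensor w).
Proof.
move=> sw; apply: continuous_big => [|l _]; first exact: mul_continuous.
move=> x; apply: continuous_comp; first exact: coord_continuous.
exact: smooth1_continuous.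
Qed.

(** A partial derivative of a tensor product of smooth functions is again one,
    with a single factor differentiated. *)
Lemma smooth_tensor w : (forall l, smooth1 (w l)) -> smooth (tensor w).
Proof.
have step i w' : (forall l, smooth1 (w' l)) -> exists w'',
    (forall l, smooth1 (w'' l)) /\
    forall x, is_derive x (delta_mx 0 i : 'rV[R]_d) (tensor w') (tensor w'' x).
  move=> sw; have [v sv dv] := smooth1_derive (sw i).
  exists (fun l => if l == i then v else w' l); split.
    by move=> l; case: ifP.
  move=> x; rewrite /tensor (bigD1 i)//= eqxx.
  rewrite (eq_bigr (fun l => w' l (x 0 l))); first exact: is_derive_tensor.
  by move=> l /negbTE ->.
move=> sw s; have [w' [sw' ->]] : exists w', (forall l, smooth1 (w' l)) /\
    iter_partial s (tensor w) = tensor w'.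
  elim: s => [|i s [w' [sw' /= ->]]]; first by exists w.
  have [w'' [sw'' dw]] := step i _ sw'; exists w''; split => //.
  by apply/funext => x; have [_] := dw x.
split; first exact: continuous_tensor.
by move=> i x; have [w'' [_ dw]] := step i _ sw'; have [] := dw x.
Qed.

End smooth_product.

Section boxes.
Context {R : realType} {d : nat}.
Implicit Types (a b : 'rV[R]_d).

Definition open_box a b : set 'rV[R]_d := rect (fun l => `]a 0 l, b 0 l[%classic).

Lemma measurable_open_box a b : measurable (open_box a b).
Proof. by apply: measurable_rect => l; exact: measurable_itv. Qed.

Lemma interior_box a b : (box a b)° = open_box a b.
Proof.
apply/seteqP; split => x.
  move=> ab l; rewrite /= in_itv/=.
  have xab : box a b x by exact: interior_subset.
  have /andP[al lb] := xab l.
  have cL : (h *: (delta_mx 0 l : 'rV[R]_d) + x) @[h --> 0] --> x.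
    rewrite -[X in _ --> X]add0r -[X in _ --> X + x](scale0r (delta_mx 0 l : 'rV[R]_d)).
    by apply: cvgD; [apply: cvgZr_tmp|exact: cvg_cst].
  have /nbhs_ballP[e /= e0 H] : \forall h \near (0 : R),
      box a b (h *: (delta_mx 0 l : 'rV[R]_d) + x).
    exact: cL.
  have e20 : 0 < e / 2 by rewrite divr_gt0.
  have e2e : e / 2 < e by rewrite ltr_pdivrMr// ltr_pMr// ltr1n.
  have H1 : box a b ((e / 2) *: (delta_mx 0 l : 'rV[R]_d) + x).
    by apply: H; rewrite /ball /= sub0r normrN gtr0_norm.
  have H2 : box a b ((- (e / 2)) *: (delta_mx 0 l : 'rV[R]_d) + x).
    by apply: H; rewrite /ball /= sub0r normrN normrN gtr0_norm.
  have := H1 l; have := H2 l; rewrite !mxE !eqxx /= !mulr1.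
  by move=> /andP[? ?] /andP[? ?]; apply/andP; split; lra.
move=> xab.
have H l : \forall y \near x, a 0 l <= (y : 'rV[R]_d) 0 l <= b 0 l.
  have := xab l; rewrite /= in_itv/= => /andP[al lb].
  have c := @coord_continuous R 1 d 0 l x.
  near=> y; apply/andP; split; apply: ltW; near: y.
    by apply: (cvgr_gt _ c).
  by apply: (cvgr_lt _ c).
have : \forall y \near x, forall l, a 0 l <= (y : 'rV[R]_d) 0 l <= b 0 l.
  exact: (@filter_forall _ _ (fun l (y : 'rV[R]_d) => a 0 l <= y 0 l <= b 0 l) _ _ H).
by [].
Unshelve. all: by end_near. Qed.

Lemma compact_box a b : compact (box a b).
Proof.
rewrite (_ : box a b = [set v | forall l, `[a 0 l, b 0 l]%classic (v ord0 l)]).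
  apply: (@rV_compact _ _ (fun l => `[a 0 l, b 0 l]%classic)) => l.
  exact: segment_compact.
by apply/seteqP; split=> x xab l; have := xab l; rewrite /= in_itv.
Qed.

Lemma box_subset_open_box a b (al be : 'rV[R]_d) : (forall l, a 0 l < al 0 l) ->
  (forall l, be 0 l < b 0 l) -> box al be `<=` open_box a b.
Proof.
move=> aal beb x xal l; have /andP[? ?] := xal l.
by rewrite /= in_itv/= (lt_le_trans (aal l))//= (le_lt_trans _ (beb l)).
Qed.

Lemma test_function_tensor (w : 'I_d -> R -> R) a b (al be : 'rV[R]_d) :
  (forall l, smooth1 (w l)) ->
  (forall l, a 0 l < al 0 l) -> (forall l, be 0 l < b 0 l) ->
  (forall l t, ~~ (al 0 l <= t <= be 0 l) -> w l t = 0) ->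
  test_function (box a b)° (tensor w).
Proof.
move=> sw aal beb w0; rewrite interior_box.
have sub : tsupport (tensor w) `<=` box al be.
  rewrite /tsupport; apply: (@subset_trans _ (closure (box al be))).
    apply: closureS => x /= px l; apply: contraNT px => xl.
    by rewrite /tensor (bigD1 l)//= w0// mul0r.
  rewrite -(closure_id _).1//; apply: compact_closed; last exact: compact_box.
  exact: norm_hausdorff.
split; first exact: smooth_tensor.
- by apply: subclosed_compact sub; [exact: closed_closure|exact: compact_box].
- exact: subset_trans sub (box_subset_open_box aal beb).
Qed.

End boxes.

Section tensor_theory.
Context {R : realType} {d : nat}.
Implicit Types (w : 'I_d -> R -> R) (M : 'I_d -> R).

Lemma bdd_measurable_tensor M w : (forall l, bdd_measurable (M l) (w l)) ->
  bdd_measurable (\prod_l M l) (tensor w).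
Proof.
move=> bw; split.
  apply: measurable_prod => l _.
  by apply: measurableT_comp; [have [] := bw l|exact: measurable_rV_coord].
move=> x; rewrite normr_prod ler_prod// => l _; rewrite normr_ge0/=.
by have [_] := bw l.
Qed.

Lemma tensor_cvg (w_ : nat -> 'I_d -> R -> R) w :
  (forall l t, w_ m l t @[m --> \oo] --> w l t) ->
  forall x, tensor (w_ m) x @[m --> \oo] --> tensor w x.
Proof.
move=> ww x; apply: cvg_big => [|l _]; first exact: mul_continuous.
exact: ww.
Qed.

End tensor_theory.

Lemma tensor_insert {R : realType} n (i : 'I_n.+1) (w : 'I_n.+1 -> R -> R) s x :
  tensor w (rV_insert i s (col' i x)) = w i s * \prod_(l < n.+1 | l != i) w l (x 0 l).
Proof.
rewrite /tensor (bigD1 i)//= rV_insert_eq; congr (_ * _).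
apply: eq_bigr => l li; case: (unliftP i l) li => [k ->|->]; last by rewrite eqxx.
by rewrite rV_insert_lift mxE.
Qed.

Section rays.
Context {R : realType} {d : nat}.

Definition ray (c : 'I_d -> R) : set 'rV[R]_d := rect (fun l => `]c l, +oo[%classic).

(** A pi-system that generates the sigma-algebra and whose traces on the open
    box are boxes sharing its upper corner. *)
Definition rays : set (set 'rV[R]_d) := range ray.

Lemma rays_setI_closed : setI_closed rays.
Proof.
move=> _ _ [c _ <-] [e _ <-]; exists (fun l => Num.max (c l) (e l)) => //.
apply/seteqP; split=> [x xc|x [xc xe] l].
  by split=> l; have := xc l; rewrite /= !in_itv/= !andbT gt_max => /andP[].
by have := xc l; have := xe l; rewrite /= !in_itv/= !andbT gt_max => -> ->.
Qed.

Lemma measurable_rV_rays : @measurable _ 'rV[R]_d = <<s rays >>.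
Proof.
apply/seteqP; split; last first.
  apply: smallest_sub; first exact: sigma_algebra_measurable.
  by move=> _ [c _ <-]; apply: measurable_rect => l; exact: measurable_itv.
apply: smallest_sub; first exact: smallest_sigma_algebra.
move=> A; rewrite -bigcup_seq => -[l _ [B mB <-]].
suff : measurable_fun setT (rV_coord l : g_sigma_algebraType rays -> R).
  by move=> /(_ measurableT B mB).
apply: (measurability _ (RGenOInfty.measurableE R)).
move=> _ [_ [e ->] <-].
rewrite setTI (_ : _ @^-1` _ =
    \bigcup_(N : nat) ray (fun k => if k == l then e else - N%:R)).
  by apply: bigcupT_measurable => N; apply: sub_sigma_algebra;
    exists (fun k => if k == l then e else - N%:R).
apply/seteqP; split=> x /=.
  rewrite in_itv/= andbT => el.
  exists (\max_(l' < d) (Num.truncn `|x ord0 l'|).+1)%N => //= k.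
  rewrite /= in_itv/= andbT; case: eqP => [->//|_].
  rewrite ltrNl; apply: le_lt_trans (ler_norm _) _; rewrite normrN.
  apply: (lt_le_trans (truncnS_gt _)).
  by rewrite ler_nat; exact: (leq_bigmax k).
by move=> [N _ /(_ l)]; rewrite /= eqxx.
Qed.

End rays.

(** * Integration by parts along a coordinate *)

Section integration_by_parts.
Context {R : realType} (n : nat) (a b : 'rV[R]_n.+1) (i : 'I_n.+1).
Hypothesis ab : forall l, a 0 l < b 0 l.
Variables (f : 'rV[R]_n.+1 -> R) (nu : {charge set 'rV[R]_n.+1 -> \bar R}).
Hypothesis fi : (lebesgue_rV n.+1).-integrable (open_box a b) (EFin \o f).
Hypothesis Df : distr_partial a b i f nu.
Notation leb := (@lebesgue_measure R).
Notation lebn := (lebesgue_rV n.+1).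
Let O := open_box a b.
Let L := b 0 i - a 0 i.
Let nup := jordan_pos (hahn_posneg nu).
Let nun := jordan_neg (hahn_posneg nu).
Let L0 : 0 < L. Proof. by rewrite subr_gt0. Qed.
Let mO : measurable O. Proof. exact: measurable_open_box. Qed.

Let kmean : R * 'rV[R]_n.+1 -> R := cst L^-1.

(** The integral of [g] against this kernel is the antiderivative, vanishing on
    the face [x_i = a_i], of [g] minus its slice mean.  The indicator of the
    open box keeps the kernel bounded. *)
Let keta (p : R * 'rV[R]_n.+1) : R :=
  \1_O p.2 * (\1_[set p : R * 'rV[R]_n.+1 | p.1 <= p.2 0 i] p - (p.2 0 i - a 0 i) / L).

Let bkmean : bdd_measurable `|L^-1| kmean. Proof. exact: bdd_measurable_cst. Qed.

Let bketa : bdd_measurable 1 keta.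
Proof.
split.
  apply: measurable_funM.
    exact: (measurableT_comp (measurable_indic mO) measurable_snd).
  have mi : measurable_fun setT (fun p : R * 'rV[R]_n.+1 => p.2 0 i).
    exact: (measurableT_comp (measurable_rV_coord i) measurable_snd).
  apply: measurable_funB.
    apply: measurable_indic; rewrite -[X in measurable X]setTI.
    by apply: measurable_fun_le => //; exact: measurable_fst.
  by apply: measurable_funM => //; exact: measurable_funB.
move=> [s x]; rewrite /keta /= normrM indicE.
have [/set_mem xO|_] := boolP (x \in O); last by rewrite normr0 mul0r.
rewrite normr1 mul1r.
have := xO i; rewrite /= in_itv/= => /andP[ax xb].
have t0 : 0 <= (x 0 i - a 0 i) / L by rewrite divr_ge0 ?ltW// subr_gt0.
have t1 : (x 0 i - a 0 i) / L <= 1 by rewrite ler_pdivrMr// mul1r /L lerB// ltW.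
rewrite indicE; case: (_ \in _); rewrite ler_norml /=; set t := _ / _ in t0 t1 *;
  by apply/andP; split; lra.
Qed.

Definition slice_mean := slice_op i (a 0 i) (b 0 i) kmean.
Definition slice_prim := slice_op i (a 0 i) (b 0 i) keta.

(** The integral against [D_i f] as a real number.  The constant factor gives
    each term the shape to which [Rintegral_bp_linear] applies. *)
Definition charge_int h : R :=
  \int[nup]_(x in O) (cst 1 x * h x) + (-1) * \int[nun]_(x in O) (cst 1 x * h x).

(** The error in the integration by parts of [g] minus its slice mean: the
    subtraction makes the antiderivative vanish on both faces and turns a
    statement about centered functions into one about all bounded measurable
    functions. *)
Definition ibp_defect g : R :=
  \int[lebn]_(x in O) (f x * (g x - slice_mean g x)) + 1 * charge_int (slice_prim g).

Let fin1 (m : {finite_measure set 'rV[R]_n.+1 -> \bar R}) :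
  m.-integrable O (EFin \o cst 1).
Proof. exact: finite_measure_integrable_cst. Qed.

Lemma bp_linear_charge_int : bp_linear charge_int.
Proof. by apply: bp_linearDZ; apply: Rintegral_bp_linear => //; exact: fin1. Qed.

Let bpo_prim := bp_operator_slice i (a 0 i) (b 0 i) bketa.
Let bpo_mean := bp_operator_slice i (a 0 i) (b 0 i) bkmean.

Lemma bp_linear_ibp_defect : bp_linear ibp_defect.
Proof.
apply: bp_linearDZ.
  apply: (@bp_linear_comp _ _ _ _ (fun g x => g x - slice_mean g x)
    (Rintegral_bp_linear mO fi)).
  exact: bp_operatorB bp_operator_id bpo_mean.
exact: bp_linear_comp bp_linear_charge_int bpo_prim.
Qed.

Lemma charge_integralE M h : bdd_measurable M h ->
  charge_integral nu O h = (charge_int h)%:E.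
Proof.
move=> bh; rewrite /charge_int /charge_integral /Rintegral mulN1r EFinB.
by congr (_ - _)%E; under eq_integral do rewrite mul1r; rewrite fineK//;
  apply: integrable_fin_num => //; under eq_fun do rewrite -(mul1r (h _));
  exact: integrable_bdd_measurable (fin1 _) bh.
Qed.

Let insO x s : O x -> `]a 0 i, b 0 i[%classic s -> O (rV_insert i s (col' i x)).
Proof.
move=> xO sab l; case: (unliftP i l) => [k ->|->]; last by rewrite rV_insert_eq.
by rewrite rV_insert_lift mxE.
Qed.

Lemma eq_slice_prim g g' : (forall x, O x -> g x = g' x) -> slice_prim g = slice_prim g'.
Proof.
move=> gg'; apply/funext => x; apply: eq_Rintegral => s /set_mem sab.
rewrite /keta /= indicE; have [/set_mem xO|_] := boolP (x \in O); last by rewrite !mul0r.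
by rewrite gg'//; exact: insO.
Qed.

Lemma eq_ibp_defect g g' : (forall x, O x -> g x = g' x) -> ibp_defect g = ibp_defect g'.
Proof.
move=> gg'; have E x : O x -> slice_mean g x = slice_mean g' x.
  by move=> xO; apply: eq_Rintegral => s /set_mem sab; rewrite gg'//; exact: insO.
rewrite /ibp_defect (@eq_Rintegral _ _ _ _ _ (fun x => f x * (g' x - slice_mean g' x))).
  by rewrite (eq_slice_prim gg').
by move=> x /set_mem xO; rewrite gg'// E.
Qed.

Let int_le x (v : R -> R) : O x -> \int[leb]_(s in `]a 0 i, b 0 i[)
   (\1_[set p : R * 'rV[R]_n.+1 | p.1 <= p.2 0 i] (s, x) * v s) =
  \int[leb]_(s in `]a 0 i, x 0 i]) v s.
Proof.
move=> xO; have := xO i; rewrite /= in_itv/= => /andP[ax xb].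
have -> : `]a 0 i, x 0 i]%classic = `]a 0 i, b 0 i[%classic `&` [set s | s <= x 0 i].
  apply/seteqP; split=> s /=; rewrite !in_itv/=.
    by move=> /andP[-> sx]; split => //; exact: le_lt_trans xb.
  by move=> [/andP[->]].
rewrite Rintegral_mkcondr; apply: eq_Rintegral => s _.
rewrite patchE indicE; have [sx|sx] := boolP (s <= x 0 i).
  by rewrite !mem_set//= mul1r.
by rewrite !memNset ?mul0r//=; exact/negP.
Qed.

Let int_prim x (v : R -> R) M : bdd_measurable M v -> O x ->
  \int[leb]_(s in `]a 0 i, b 0 i[) (keta (s, x) * v s) =
  \int[leb]_(s in `]a 0 i, x 0 i]) v s -
  (x 0 i - a 0 i) / L * \int[leb]_(s in `]a 0 i, b 0 i[) v s.
Proof.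
move=> bv xO; rewrite -(int_le _ xO).
have iv := bounded_integrable_itv (a 0 i) (b 0 i) bv.
have iv' : leb.-integrable `]a 0 i, b 0 i[ (EFin \o (fun s =>
    \1_[set p : R * 'rV[R]_n.+1 | p.1 <= p.2 0 i] (s, x) * v s)).
  apply: (@bounded_integrable_itv _ _ _ (1 * M)).
  apply: (bdd_measurableM _ bv).
  have b1 : bdd_measurable 1 (\1_[set p : R * 'rV[R]_n.+1 | p.1 <= p.2 0 i] : _ -> R).
    apply: bdd_measurable_indic; rewrite -[X in measurable X]setTI.
    apply: measurable_fun_le => //.
    exact: (measurableT_comp (measurable_rV_coord i) measurable_snd).
  by case: b1 => m1 b1; split => //; exact: (measurableT_comp m1 (pair2_measurable _)).
rewrite -RintegralZl// -RintegralB//; last first.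
  exact: (bounded_integrable_itv _ _
    (bdd_measurableM (bdd_measurable_cst ((x 0 i - a 0 i) / L)) bv)).
apply: eq_Rintegral => s _; rewrite /keta /= indicE mem_set// mul1r mulrBl.
by [].
Qed.

(** A function constant along the slices equals its slice mean. *)
Lemma ibp_defect_indep (h : 'rV[R]_n -> R) : ibp_defect (fun x => h (col' i x)) = 0.
Proof.
have mean x : slice_mean (fun x => h (col' i x)) x = h (col' i x).
  rewrite /slice_mean /slice_op.
  transitivity (\int[leb]_(s in `]a 0 i, b 0 i[) cst (L^-1 * h (col' i x)) s).
    by apply: eq_Rintegral => s _; rewrite col'_insert.
  rewrite Rintegral_cst//= lebesgue_measure_itv /= lte_fin ab /= -/L.
  by rewrite mulrAC mulVf ?mul1r// gt_eqF.
have prim x : O x -> slice_prim (fun x => h (col' i x)) x = 0.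
  move=> xO; rewrite /slice_prim /slice_op.
  under eq_Rintegral do rewrite col'_insert.
  rewrite (int_prim (bdd_measurable_cst _) xO) !Rintegral_cst//= !lebesgue_measure_itv /=.
  have := xO i; rewrite /= in_itv/= => /andP[ax xb].
  rewrite !lte_fin ab ax /= -/L.
  by field; rewrite gt_eqF.
rewrite /ibp_defect /charge_int.
rewrite [X in X + _](_ : _ = 0); last first.
  rewrite -[RHS](mul0r (fine (lebn O))) -Rintegral_cst//; apply: eq_Rintegral => x _.
  by rewrite mean subrr mulr0.
have z (m : {measure set 'rV[R]_n.+1 -> \bar R}) :
    \int[m]_(x in O) (cst 1 x * slice_prim (fun x => h (col' i x)) x) = 0.
  rewrite -[RHS](mul0r (fine (m O))) -Rintegral_cst//; apply: eq_Rintegral => x.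
  by move=> /set_mem xO; rewrite prim// mulr0.
by rewrite !z; ring.
Qed.

(** As the [i]th factor has zero mean, replacing it by its antiderivative gives
    a test function whose [i]th partial derivative is [tensor w]. *)
Lemma ibp_defect_tensor (w : 'I_n.+1 -> R -> R) (M : 'I_n.+1 -> R)
    (al be : 'rV[R]_n.+1) :
  (forall l, smooth1 (w l)) -> (forall l t, `|w l t| <= M l) ->
  (forall l, a 0 l < al 0 l) -> (forall l, be 0 l < b 0 l) ->
  (forall l t, ~~ (al 0 l <= t <= be 0 l) -> w l t = 0) ->
  \int[leb]_(s in `]a 0 i, b 0 i[) w i s = 0 ->
  ibp_defect (tensor w) = 0.
Proof.
move=> sw wM aal beb w0 wi0.
have bw l : bdd_measurable (M l) (w l) by split => //; exact: smooth1_measurable.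
have [U sU [dU U0 UE]] := smooth1_zero_mean_primitive (aal i) (beb i) (sw i) (w0 i) wi0.
pose w' l := if l == i then U else w l.
have c' x : \prod_(l < n.+1 | l != i) w' l (x 0 l) =
    \prod_(l < n.+1 | l != i) w l (x 0 l).
  by apply: eq_bigr => l li; rewrite /w' (negbTE li).
have tw' : test_function (box a b)° (tensor w').
  apply: (test_function_tensor (al := al) (be := be)) => //.
  - by move=> l; rewrite /w'; case: eqP.
  - by move=> l t; rewrite /w'; case: eqP => [->|_]; [exact: U0|exact: w0].
have pw' : partial i (tensor w') = tensor w.
  apply/funext => x; rewrite /partial.
  have dw' : is_derive (x 0 i) (1 : R) (w' i) (w i (x 0 i)).
    by rewrite /w' eqxx; exact: dU.
  have [_ ->] := is_derive_tensor dw'.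
  by rewrite c' [RHS](bigD1 i).
have mean x : slice_mean (tensor w) x = 0.
  rewrite /slice_mean /slice_op.
  transitivity (\int[leb]_(s in `]a 0 i, b 0 i[)
      (L^-1 * \prod_(l < n.+1 | l != i) w l (x 0 l) * w i s)).
    by apply: eq_Rintegral => s _; rewrite tensor_insert -mulrA [X in L^-1 * X]mulrC.
  rewrite RintegralZl ?wi0 ?mulr0//.
  exact: bounded_integrable_itv (bw i).
have prim x : O x -> slice_prim (tensor w) x = tensor w' x.
  move=> xO; rewrite /slice_prim /slice_op.
  under eq_Rintegral => s _ do rewrite tensor_insert mulrA mulrC.
  have bk : bdd_measurable (1 * M i) (fun s => keta (s, x) * w i s).
    apply: (bdd_measurableM _ (bw i)); case: bketa => mk kb.
    by split => //; exact: (measurableT_comp mk (pair2_measurable _)).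
  rewrite RintegralZl//; last exact: bounded_integrable_itv bk.
  rewrite (int_prim (bw i) xO) wi0 mulr0 subr0 -UE; last first.
    by have := xO i; rewrite /= in_itv/= => /andP[].
  by rewrite [RHS](bigD1 i)//= c' /w' eqxx mulrC.
have bp : exists N, bdd_measurable N (slice_prim (tensor w)).
  have [bpo _ _] := bpo_prim; have [N HN] := bpo (\prod_l M l).
  by exists N; apply: HN; exact: bdd_measurable_tensor.
have [N bN] := bp.
have := Df tw'; rewrite pw' interior_box.
have -> : charge_integral nu (open_box a b) (tensor w') =
    charge_integral nu O (slice_prim (tensor w)).
  rewrite /charge_integral; congr (_ - _)%E; apply: eq_integral => x /set_mem xO;
    by rewrite prim.
rewrite (charge_integralE bN) => H.
rewrite /ibp_defect (_ : \int[lebn]_(x in O) _ = - charge_int (slice_prim (tensor w))).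
  by rewrite mul1r addNr.
rewrite /Rintegral -[RHS]/(fine (- (charge_int (slice_prim (tensor w)))%:E)) -H.
by congr fine; apply: eq_integral => x _; rewrite mean subr0.
Qed.

Let m (u : R -> R) := \int[leb]_(s in `]a 0 i, b 0 i[) u s.

Let m_indic : m \1_(`]a 0 i, b 0 i[%classic) = L.
Proof.
rewrite /m (@eq_Rintegral _ _ _ _ _ (cst 1)).
  by rewrite Rintegral_cst//= lebesgue_measure_itv /= lte_fin ab /= mul1r.
by move=> s; rewrite inE => sab; rewrite indicE mem_set.
Qed.

Let bdd_measurable_bump c d k : bdd_measurable 1 (smooth_bump c d k : R -> R).
Proof.
split; first by apply: smooth1_measurable; exact: smooth1_bump.
by move=> t; have /andP[? ?] := smooth_bump_itv c d k t; rewrite ger0_norm.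
Qed.

Let m_bump_cvg c d : m (smooth_bump c d k) @[k --> \oo] --> m \1_(`]c, d[%classic).
Proof.
have i1 := bounded_integrable_itv (a 0 i) (b 0 i) (bdd_measurable_cst 1).
have [_ H] := @Rintegral_bp_linear _ _ _ leb `]a 0 i, b 0 i[%classic _ (measurable_itv _) i1.
have E u : m u = \int[leb]_(s in `]a 0 i, b 0 i[) (cst 1 s * u s).
  by apply: eq_Rintegral => s _; rewrite mul1r.
under eq_fun do rewrite E; rewrite E.
apply: (H 1) => [k|t]; [exact: bdd_measurable_bump|exact: smooth_bump_cvg].
Qed.

Let m_bump_le c d k : `|m (smooth_bump c d k)| <= L.
Proof.
have ib := bounded_integrable_itv (a 0 i) (b 0 i) (bdd_measurable_bump c d k).
apply: le_trans (le_normr_Rintegral _ ib) _ => //.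
rewrite -m_indic; apply: le_Rintegral => //.
- exact: integrable_norm.
- by apply: bounded_integrable_itv; apply: bdd_measurable_indic; exact: measurable_itv.
- move=> s sab; rewrite indicE mem_set//.
  by have [_] := bdd_measurable_bump c d k.
Qed.

(** Let [chi] be the bump approximating the [i]th factor and [psi] the bump
    approximating the indicator of [ ]a_i, b_i[ ].  The combination
    [m(psi) * chi - m(chi) * psi], where [m] is the integral, has zero mean, so
    that the previous lemma applies.  In the limit, the term coming from [psi]
    is constant along the slices and [m(psi)] becomes [b_i - a_i], which is not
    zero. *)
Lemma ibp_defect_ray (e : 'I_n.+1 -> R) : ibp_defect \1_(ray e) = 0.
Proof.
have comb0 (p q : R) : p * 0 - q * 0 = 0 by rewrite !mulr0 subr0.
have comb_comm (p q : R) : p * q - q * p = 0 by rewrite mulrC subrr.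
(* [c] gives the lower endpoints of the trace of [ray e] on the open box. *)
have [c ac ce] : exists2 c : 'I_n.+1 -> R, forall l, a 0 l <= c l &
    forall l t, a 0 l < t -> (c l < t) = (e l < t).
  exists (fun l => Num.max (a 0 l) (e l)) => l; first by rewrite le_max lexx.
  by move=> t at_; rewrite gt_max at_.
pose v k t := m (smooth_bump (a 0 i) (b 0 i) k) * smooth_bump (c i) (b 0 i) k t -
              m (smooth_bump (c i) (b 0 i) k) * smooth_bump (a 0 i) (b 0 i) k t.
pose w k l := if l == i then v k else smooth_bump (c l) (b 0 l) k.
pose chi l : R -> R := \1_(`]c l, b 0 l[%classic).
pose mc := m (chi i).
pose vlim t := L * chi i t - mc * \1_(`]a 0 i, b 0 i[%classic) t.
pose wlim l := if l == i then vlim else chi l.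
pose h := tensor (fun l => if l == i then cst 1 else chi l).
have bchi l : bdd_measurable 1 (chi l) by apply: bdd_measurable_indic; exact: measurable_itv.
have bv k : bdd_measurable (L * 1 + L * 1) (v k).
  split.
    by apply: measurable_funB; apply: measurable_funM => //;
      apply: smooth1_measurable; exact: smooth1_bump.
  move=> t; rewrite (le_trans (ler_normB _ _))// !normrM lerD// ler_pM//;
    by [exact: m_bump_le|have [_] := bdd_measurable_bump (c i) (b 0 i) k|
        have [_] := bdd_measurable_bump (a 0 i) (b 0 i) k].
have bw k l : bdd_measurable (if l == i then L * 1 + L * 1 else 1) (w k l).
  by rewrite /w; case: eqP => // _; exact: bdd_measurable_bump.
have w_lim l t : w k l t @[k --> \oo] --> wlim l t.
  rewrite /w /wlim; case: eqP => _; last exact: smooth_bump_cvg.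
  apply: cvgB; apply: cvgM;
    [|exact: smooth_bump_cvg|exact: m_bump_cvg|exact: smooth_bump_cvg].
  by rewrite -m_indic; exact: m_bump_cvg.
have ibp_defect_w k : ibp_defect (tensor (w k)) = 0.
  pose al := \row_l (a 0 l + k.+1%:R^-1) : 'rV[R]_n.+1.
  pose be := \row_l (b 0 l - k.+1%:R^-1) : 'rV[R]_n.+1.
  have out_bump c' l t : a 0 l <= c' -> ~~ (al 0 l <= t <= be 0 l) ->
      smooth_bump c' (b 0 l) k t = 0.
    move=> ac'; rewrite !mxE => out; apply: smooth_bump_out; apply: contra out.
    by move=> /andP[ct ->]; rewrite andbT (le_trans _ ct)// lerD2r.
  apply: (@ibp_defect_tensor _ (fun l => if l == i then L * 1 + L * 1 else 1) al be).
  - move=> l; rewrite /w; case: eqP => _; last exact: smooth1_bump.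
    by apply: smooth1B; apply: smooth1Z; exact: smooth1_bump.
  - by move=> l t; have [_] := bw k l.
  - by move=> l; rewrite mxE ltrDl invr_gt0.
  - by move=> l; rewrite mxE ltrBlDr ltrDl invr_gt0.
  - move=> l t out; rewrite /w; case: eqP => [li|_]; last exact: out_bump.
    rewrite li in out; have o1 := out_bump _ _ _ (ac i) out.
    have o2 := out_bump _ _ _ (lexx _) out.
    apply: etrans (f_equal2 (fun u u' => m (smooth_bump (a 0 i) (b 0 i) k) * u -
      m (smooth_bump (c i) (b 0 i) k) * u') o1 o2) _.
    exact: comb0.
  - rewrite /w eqxx /v.
    have i1 := bounded_integrable_itv (a 0 i) (b 0 i) (bdd_measurable_bump (c i) (b 0 i) k).
    have i2 := bounded_integrable_itv (a 0 i) (b 0 i) (bdd_measurable_bump (a 0 i) (b 0 i) k).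
    rewrite RintegralB// ?RintegralZl//.
    + exact: (bounded_integrable_itv _ _
        (bdd_measurableM (bdd_measurable_cst _) (bdd_measurable_bump _ _ _))).
    + exact: (bounded_integrable_itv _ _
        (bdd_measurableM (bdd_measurable_cst _) (bdd_measurable_bump _ _ _))).
have bwl := bdd_measurable_lim (fun k => bdd_measurable_tensor (bw k)) (tensor_cvg w_lim).
have ibp_defect_lim : ibp_defect (tensor wlim) = 0.
  exact: (bp_linear_lim_eq0 bp_linear_ibp_defect (fun k => bdd_measurable_tensor (bw k))
    (tensor_cvg w_lim) ibp_defect_w).
have bh : bdd_measurable (\prod_(l < n.+1) 1) h.
  apply: bdd_measurable_tensor => l; case: eqP => _ //.
  by split => // t; rewrite normr1.
have ibp_defect_h : ibp_defect h = 0.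
  rewrite (_ : h = (fun x => (h \o rV_insert i 0) (col' i x))).
    exact: ibp_defect_indep.
  apply/funext => x /=; rewrite /h tensor_insert [LHS](bigD1 i)//= !eqxx.
  by [].
have bray : bdd_measurable 1 (\1_(ray e) : 'rV[R]_n.+1 -> R).
  by apply: bdd_measurable_indic; apply: measurable_rect => l; exact: measurable_itv.
have [lin _] := bp_linear_ibp_defect.
have b0 : bdd_measurable `|0 : R| (cst 0 : 'rV[R]_n.+1 -> R) by exact: bdd_measurable_cst.
have H1 := lin _ _ _ _ L b0 bray.
have H2 := lin _ _ _ _ mc bwl bh.
have E : ibp_defect (fun x => cst 0 x + L * \1_(ray e) x) =
         ibp_defect (fun x => tensor wlim x + mc * h x).
  apply: eq_ibp_defect => x xO;
  rewrite /= add0r /h /tensor (bigD1 i)//= [in X in _ + _ * X](bigD1 i)//=.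
  rewrite /wlim eqxx /= mul1r.
  rewrite (eq_bigr (fun l => chi l (x 0 l))) => [|l /negbTE->//].
  rewrite [in X in _ + _ * X](eq_bigr (fun l => chi l (x 0 l))) => [|l /negbTE->//].
  rewrite /vlim [\1_(`]a 0 i, _[%classic) _]indicE (mem_set (xO i)) /= mulr1.
  rewrite -mulrDl subrK -mulrA; congr (_ * _).
  have chiE l : chi l (x 0 l) = (e l < x 0 l)%R%:R :> R.
    have := xO l; rewrite /= in_itv/= /chi indicE => /andP[al bl].
    rewrite (_ : (_ \in _) = (e l < x 0 l)%R)//.
    by apply/idP/idP; rewrite inE /= in_itv/= bl andbT ce.
  transitivity (\prod_(l < n.+1) chi l (x 0 l)); last exact: (bigD1 i).
  rewrite indicE; have [/set_mem xr|xr] := boolP (x \in ray e).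
    rewrite big1// => l _; rewrite chiE.
    by have := xr l; rewrite /= in_itv/= andbT => ->.
  have : ~ forall l, e l < x 0 l.
    move=> H; move/negP: xr; apply; rewrite inE => l.
    by rewrite /= in_itv/= andbT; exact: H.
  move=> /existsNP[l /negP/negbTE H].
  by rewrite (bigD1 l)//= chiE H mul0r.
rewrite E H2 ibp_defect_lim ibp_defect_h (bp_linear0 bp_linear_ibp_defect) mulr0 !add0r in H1.
exact: (mulfI (lt0r_neq0 L0) (etrans (esym H1) (esym (mulr0 L)))).
Qed.

Lemma ibp_defect_eq0 M g : bdd_measurable M g -> ibp_defect g = 0.
Proof.
apply: (bp_linear_eq0 bp_linear_ibp_defect measurable_rV_rays rays_setI_closed).
- exact: (ibp_defect_indep (cst 1)).
- by move=> _ [e _ <-]; exact: ibp_defect_ray.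
Qed.

(** The integrals over the two parts of the slice are opposite, so twice the
    absolute value of either is at most the total integral of [|v|]. *)
Let slice_bound (v : R -> R) M C t : bdd_measurable M v -> a 0 i < t < b 0 i ->
  \int[leb]_(s in `]a 0 i, b 0 i[) v s = 0 ->
  \int[leb]_(s in `]a 0 i, b 0 i[) `|v s| <= C ->
  `|\int[leb]_(s in `]a 0 i, t]) v s| <= C / 2.
Proof.
move=> bv /andP[at_ tb].
have bn : bdd_measurable M (fun s => `|v s|).
  by case: bv => mv vM; split => [|s]; [exact: measurableT_comp|rewrite normr_id].
have D : `]a 0 i, b 0 i[%classic = `]a 0 i, t] `|` `]t, b 0 i[%classic.
  by rewrite -itv_bndbnd_setU// bnd_simp ltW.
have split_int (u : R -> R) N : bdd_measurable N u ->
    \int[leb]_(s in `]a 0 i, b 0 i[) u s =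
    \int[leb]_(s in `]a 0 i, t]) u s + \int[leb]_(s in `]t, b 0 i[) u s.
  move=> bu; rewrite D Rintegral_setU//.
    by rewrite -D; exact: bounded_integrable_itv bu.
  apply/disj_setPS => y [/=]; rewrite 2!in_itv/= => /andP[_ yx] /andP[].
  by rewrite ltNge yx.
have i1 : leb.-integrable `]a 0 i, t] (EFin \o v).
  apply: integrableS (bounded_integrable_itv (a 0 i) (b 0 i) bv) => //.
  by rewrite D; exact: subsetUl.
have i2 : leb.-integrable `]t, b 0 i[ (EFin \o v).
  exact: bounded_integrable_itv bv.
rewrite (split_int _ _ bv) (split_int _ _ bn) => v0 vC.
have n1 := @le_normr_Rintegral _ _ _ leb _ _ (measurable_itv _) i1.
have n2 := @le_normr_Rintegral _ _ _ leb _ _ (measurable_itv _) i2.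
have E : `|\int[leb]_(s in `]a 0 i, t]) v s| = `|\int[leb]_(s in `]t, b 0 i[) v s|.
  by rewrite -[RHS]normrN; congr `|_|; apply/eqP; rewrite -addr_eq0 v0.
rewrite ler_pdivlMr// mulr_natr mulr2n {2}E.
exact: le_trans (lerD n1 n2) vC.
Qed.

Let charge_int_le (h : 'rV[R]_n.+1 -> R) M K : bdd_measurable M h ->
  (forall x, O x -> `|h x| <= K) -> (`|charge_int h|%:E <= K%:E * Defs.variation nu O)%E.
Proof.
move=> bh hK.
have int_le' (mu : {finite_measure set 'rV[R]_n.+1 -> \bar R}) :
    `|\int[mu]_(x in O) (cst 1 x * h x)| <= K * fine (mu O).
  have ih := integrable_bdd_measurable mO (fin1 mu) bh.
  apply: le_trans (le_normr_Rintegral mO ih) _.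
  rewrite -Rintegral_cst//; apply: le_Rintegral => //.
  - exact: integrable_norm.
  - exact: finite_measure_integrable_cst.
  - by move=> x xO; rewrite mul1r hK.
have -> : Defs.variation nu O = (fine (nup O) + fine (nun O))%:E.
  by rewrite EFinD !fineK//; exact: fin_num_measure.
rewrite -EFinM lee_fin /charge_int mulN1r mulrDr (le_trans (ler_normB _ _))//.
by rewrite lerD ?int_le'.
Qed.

Lemma zero_mean_bound M C g : bdd_measurable M g ->
  (forall x, \int[leb]_(s in `]a 0 i, b 0 i[) g (rV_insert i s (col' i x)) = 0) ->
  (forall x, \int[leb]_(s in `]a 0 i, b 0 i[) `|g (rV_insert i s (col' i x))| <= C) ->
  (`|\int[lebn]_(x in O) (f x * g x)|%:E <= (C / 2)%:E * Defs.variation nu O)%E.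
Proof.
move=> bg g0 gC; have := ibp_defect_eq0 bg; rewrite /ibp_defect mul1r.
rewrite (@eq_Rintegral _ _ _ _ _ (fun x => f x * g x)) => [/eqP|x _]; last first.
  rewrite /slice_mean /slice_op RintegralZl ?g0 ?mulr0 ?subr0//.
  exact: (bounded_integrable_itv _ _ (bdd_measurable_slice i x bg)).
rewrite addr_eq0 => /eqP ->; rewrite normrN.
have [bpo _ _] := bpo_prim; have [N HN] := bpo M.
apply: (charge_int_le (HN _ bg)) => x xO.
rewrite /slice_prim /slice_op (int_prim (bdd_measurable_slice i x bg) xO) g0 mulr0 subr0.
apply: slice_bound (bdd_measurable_slice i x bg) _ (g0 x) (gC x).
by have := xO i; rewrite /= in_itv.
Qed.

End integration_by_parts.

(** * Reduction to bounded functions centered on every slice *)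

Section null_sets.
Context {R : realType}.

Lemma ae_lebesgue_boxP d (a b : 'rV[R]_d) (P : 'rV[R]_d -> Prop) :
  {ae lebesgue_box a b, forall w, P w} ->
  exists N, [/\ measurable N, lebesgue_rV d N = 0%E &
    forall w, box a b w -> ~ N w -> P w].
Proof.
move=> [N [mN N0 PN]]; exists (N `&` box a b); split.
- by apply: measurableI => //; exact: measurable_box.
- exact: N0.
- by move=> w wab Nw; apply: contrapT => Pw; apply: Nw; split => //; exact: PN.
Qed.

Lemma ae_lebesgue_boxI d (a b : 'rV[R]_d) (P : 'rV[R]_d -> Prop) N :
  measurable N -> lebesgue_rV d N = 0%E ->
  (forall w, box a b w -> ~ N w -> P w) ->
  {ae lebesgue_box a b, forall w, P w}.
Proof.
move=> mN N0 NP; exists (N `|` ~` box a b); split.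
- by apply: measurableU => //; apply: measurableC; exact: measurable_box.
- rewrite /= /lebesgue_box /mrestr/= setIUl setICl setU0.
  apply: (subset_measure0 _ mN) => //.
  by apply: measurableI => //; exact: measurable_box.
- move=> w /= Pw; apply: contrapT => /not_orP[Nw /contrapT wab].
  by apply: Pw; exact: NP.
Qed.

Lemma lebesgue_rV_boxD d (a b : 'rV[R]_d) : (forall l, a 0 l < b 0 l) ->
  lebesgue_rV d (box a b `\` open_box a b) = 0%E.
Proof.
move=> ab; have oab : open_box a b `<=` box a b.
  by rewrite -interior_box; exact: interior_subset.
have Sfin := lebesgue_rV_box (fun l => ltW (ab l)).
have -> : (lebesgue_rV d (box a b `\` open_box a b) =
    lebesgue_rV d (box a b) - lebesgue_rV d (open_box a b))%E.
  rewrite measureD; [|exact: measurable_box|exact: measurable_open_box|].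
    by rewrite setIC (setIidl oab).
  by rewrite [ltLHS]Sfin ltry.
rewrite lebesgue_rV_rect//; rewrite Sfin.
rewrite (eq_bigr (fun l => (b 0 l - a 0 l)%:E)) => [|l _].
  by rewrite prodEFin subee.
by rewrite lebesgue_measure_itv /= lte_fin ab.
Qed.

End null_sets.

Section coordinate.
Context {R : realType} (n : nat) (a b : 'rV[R]_n.+1) (i : 'I_n.+1).
Hypothesis ab : forall l, a 0 l < b 0 l.
Notation S := (box a b).
Notation S' := (box (col' i a) (col' i b)).
Notation O := (open_box a b).
Notation leb := (@lebesgue_measure R).
Notation lebn := (lebesgue_rV n.+1).
Variables (phi : 'rV[R]_n.+1 -> R) (h : R).
Hypothesis mphi : measurable_fun S phi.
Hypothesis phih : {ae lebesgue_box a b, forall x, `|phi x| <= h}.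

Let ins (w : 'rV[R]_n) t := rV_insert i t w.

Let insS w t : S' w -> a 0 i <= t <= b 0 i -> S (ins w t).
Proof.
move=> wS tab l; case: (unliftP i l) => [k ->|->]; last by rewrite /ins rV_insert_eq.
by rewrite /ins rV_insert_lift; have := wS k; rewrite !mxE.
Qed.

Let measurable_ins w : measurable_fun setT (ins w).
Proof. exact: (measurableT_comp (measurable_rV_insert i) (pair2_measurable _)). Qed.

Let mslice w (g : 'rV[R]_n.+1 -> R) : S' w -> measurable_fun S g ->
  measurable_fun `[a 0 i, b 0 i] (fun t => g (ins w t)).
Proof.
move=> wS mg; apply: (measurable_comp _ _ mg); first exact: measurable_box.
  by move=> _ [t /= tab <-]; exact: insS.
exact: measurable_funTS.
Qed.

(** The points where [phi] may be kept; the others form a null set of the box,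
    its boundary included. *)
Let good := O `&` [set x | `|phi x| <= h].

Let mgood : measurable good.
Proof.
have mphiO : measurable_fun O phi.
  apply: measurable_funS mphi; first exact: measurable_box.
  by rewrite -interior_box; exact: interior_subset.
apply: measurable_fun_le; [exact: measurable_open_box| |exact: measurable_cst].
exact: measurableT_comp.
Qed.

Let bad_null : exists N, [/\ measurable N, lebn N = 0%E &
  forall x, S x -> ~ N x -> good x].
Proof.
have [N [mN N0 NP]] := ae_lebesgue_boxP phih.
exists (N `|` (S `\` O)); split.
- apply: measurableU => //; apply: measurableD; first exact: measurable_box.
  exact: measurable_open_box.
- rewrite null_set_setU//; last exact: lebesgue_rV_boxD.
  by apply: measurableD; [exact: measurable_box|exact: measurable_open_box].
- move=> x Sx /not_orP[Nx SOx]; split; last exact: NP.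
  by apply: contrapT => Ox; apply: SOx.
Qed.

Let phi1 := phi \_ good.

Let bphi1 : bdd_measurable `|h| phi1.
Proof.
split.
  apply: (measurable_restrictT _ mgood).1; apply: measurable_funS mphi.
  - exact: measurable_box.
  - by move=> x [+ _]; rewrite -interior_box; exact: interior_subset.
move=> x; rewrite /phi1 patchE; case: ifPn => [/set_mem[_ /=]|_].
  by move=> /le_trans; apply; exact: ler_norm.
by rewrite normr0.
Qed.

Let slice_good : exists N, [/\ measurable N, lebesgue_rV n N = 0%E &
  forall w, S' w -> ~ N w ->
    {ae leb, forall t, `[a 0 i, b 0 i]%classic t -> good (ins w t)}].
Proof.
have [N [mN N0 NP]] := bad_null.
have [M [mM M0 MP]] := lebesgue_rV_slice_null i mN N0.
exists M; split => // w wS Mw.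
exists [set t | N (ins w t)]; split.
- by rewrite -[X in measurable X]setTI; exact: measurable_ins.
- by apply: contrapT => H; apply: Mw; exact: MP.
- move=> t /= H; apply: contrapT => Nt; apply: H => tab.
  by apply: NP => //; apply: insS => //; move: tab; rewrite in_itv.
Qed.

(** The function [F] is the identity for the centering condition and the
    absolute value for the slice envelope. *)
Let slice_phi1 : exists N, [/\ measurable N, lebesgue_rV n N = 0%E &
  forall w, S' w -> ~ N w -> forall F : R -> R,
    measurable_fun setT F -> (forall t, `|F t| <= `|t|) ->
   (\int[leb]_(t in `[a 0%R i, b 0%R i]) (F (phi (ins w t)))%:E)%E =
   (\int[leb]_(t in `]a 0 i, b 0 i[) F (phi1 (ins w t)))%:E].
Proof.
have [N [mN N0 NP]] := slice_good.
exists N; split => // w wS Nw F mF Fle.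
have mF1 : measurable_fun setT (fun t => F (phi1 (ins w t))).
  apply: measurableT_comp => //; apply: measurableT_comp => //.
  by have [] := bphi1.
transitivity (\int[leb]_(t in `[a 0%R i, b 0%R i]) (F (phi1 (ins w t)))%:E)%E.
  apply: ae_eq_integral => //.
  - by apply/measurable_EFinP; apply: measurableT_comp => //; exact: mslice.
  - by apply/measurable_EFinP; exact: measurable_funTS.
  - have [Z [mZ Z0 ZP]] := NP _ wS Nw; exists Z; split => // t /= H.
    apply: ZP => gt; apply: H => tab; rewrite /phi1 patchE mem_set//.
    exact: gt.
have iF : leb.-integrable `]a 0 i, b 0 i[ (EFin \o (fun t => F (phi1 (ins w t)))).
  apply: (@bounded_integrable_itv _ _ _ `|h|); split => // t.
  by rewrite (le_trans (Fle _))//; have [_] := bphi1.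
rewrite /Rintegral fineK; last exact: integrable_fin_num.
rewrite [LHS]integral_mkcond [RHS]integral_mkcond.
apply: eq_integral => t _.
rewrite !patchE; case: ifPn => [_|tab]; case: ifPn => // tab'.
  rewrite /phi1 patchE memNset.
    by congr EFin; apply/eqP; rewrite -normr_le0 (le_trans (Fle _))// normr0.
  move=> [insO _]; move/negP : tab'; apply; rewrite inE.
  by have := insO i; rewrite /ins rV_insert_eq.
by move/negP: tab; case; rewrite inE; apply: subset_itv_oo_cc; rewrite inE in tab'.
Qed.

(** Multiplying by the indicator of [W] kills the slices that are not centered
    or whose absolute integral exceeds [C]; these are negligible, and after this
    the hypotheses of [zero_mean_bound] hold on every slice. *)
Lemma coordinate_bound (f : 'rV[R]_n.+1 -> R)
    (nu : {charge set 'rV[R]_n.+1 -> \bar R}) C :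
  lebn.-integrable S (EFin \o f) -> distr_partial a b i f nu -> 0 <= C ->
  {ae lebesgue_box (col' i a) (col' i b), forall w,
    (\int[leb]_(t in `[a 0%R i, b 0%R i]) (phi (rV_insert i t w))%:E)%E = 0%E} ->
  {ae lebesgue_box (col' i a) (col' i b), forall w,
    (\int[leb]_(t in `[a 0%R i, b 0%R i]) `|phi (rV_insert i t w)|%:E <= C%:E)%E} ->
  (`|expectation_density a b f phi| <= (C / 2)%:E * Defs.variation nu S°)%E.
Proof.
move=> fS Df C0 /ae_lebesgue_boxP[N1 [mN1 N10 N1P]] /ae_lebesgue_boxP[N2 [mN2 N20 N2P]].
have OS : O `<=` S by rewrite -interior_box; exact: interior_subset.
have fO : lebn.-integrable O (EFin \o f).
  by apply: integrableS fS => //; [exact: measurable_box|exact: measurable_open_box].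
have [N3 [mN3 N30 N3P]] := slice_phi1.
pose I1 w := \int[leb]_(t in `]a 0 i, b 0 i[) phi1 (ins w t).
pose I2 w := \int[leb]_(t in `]a 0 i, b 0 i[) `|phi1 (ins w t)|.
pose W := [set w | I1 w = 0] `&` [set w | I2 w <= C].
have mphi1i : measurable_fun setT (fun p : R * 'rV[R]_n => phi1 (rV_insert i p.1 p.2)).
  by apply: measurableT_comp; [have [] := bphi1|exact: measurable_rV_insert].
have mW : measurable W.
  apply: measurableI.
    suff mI1 : measurable_fun setT I1.
      by rewrite -[X in measurable X]setTI; exact: (mI1 measurableT [set 0]).
    exact: (@measurable_fun_Rintegral _ _ _ _ _ leb _
      (fun p : R * 'rV[R]_n => phi1 (rV_insert i p.1 p.2))).
  rewrite -[X in measurable X]setTI; apply: measurable_fun_le => //.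
  apply: (@measurable_fun_Rintegral _ _ _ _ _ leb _
    (fun p : R * 'rV[R]_n => `|phi1 (rV_insert i p.1 p.2)|)) => //.
  exact: measurableT_comp.
pose phi2 x := phi1 x * \1_W (col' i x).
have bphi2 : bdd_measurable (`|h| * 1) phi2.
  apply: bdd_measurableM => //; split.
    exact: (measurableT_comp (measurable_indic mW) (measurable_col' i)).
  by have [_ H] := bdd_measurable_indic (R := R) mW.
have phi2_slice x t : phi2 (rV_insert i t (col' i x)) =
    phi1 (ins (col' i x) t) * \1_W (col' i x).
  by rewrite /phi2 col'_insert.
have phi20 x : \int[leb]_(t in `]a 0 i, b 0 i[) phi2 (rV_insert i t (col' i x)) = 0.
  under eq_Rintegral do rewrite phi2_slice indicE.
  have [/set_mem[W1 _]|_] := boolP (col' i x \in W).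
    by rewrite -[RHS]W1; apply: eq_Rintegral => t _; rewrite mulr1.
  rewrite -[RHS](mul0r (fine (leb `]a 0 i, b 0 i[%classic))) -Rintegral_cst//.
  by apply: eq_Rintegral => t _; rewrite mulr0.
have phi2C x : \int[leb]_(t in `]a 0 i, b 0 i[) `|phi2 (rV_insert i t (col' i x))| <= C.
  under eq_Rintegral do rewrite phi2_slice indicE.
  have [/set_mem[_ W2]|_] := boolP (col' i x \in W).
    by apply: le_trans W2; under eq_Rintegral do rewrite mulr1.
  apply: le_trans C0; rewrite -[leRHS](mul0r (fine (leb `]a 0 i, b 0 i[%classic))).
  rewrite -Rintegral_cst// (@eq_Rintegral _ _ _ _ _ (cst 0))// => t _.
  by rewrite mulr0 normr0.
have := zero_mean_bound ab fO Df bphi2 phi20 phi2C.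
rewrite interior_box; apply: le_trans.
suff -> : expectation_density a b f phi = (\int[lebn]_(x in O) (f x * phi2 x))%:E by [].
have mf : measurable_fun S f by apply/measurable_EFinP; exact: measurable_int fS.
rewrite /expectation_density.
transitivity (\int[lebn]_(x in S) (phi2 x * f x)%:E)%E.
  have [N4 [mN4 N40 N4P]] := bad_null.
  have mcol N : measurable N -> measurable [set x | N (col' i x)].
    by move=> mN; rewrite -[X in measurable X]setTI; exact: measurable_col'.
  apply: ae_eq_integral => //.
  - exact: measurable_box.
  - by apply/measurable_EFinP; exact: measurable_funM.
  - apply/measurable_EFinP; apply: measurable_funM => //.
    by apply: measurable_funTS; have [] := bphi2.
  - exists (N4 `|` [set x | (N1 `|` N2 `|` N3) (col' i x)]); split.
    + apply: measurableU => //; apply: mcol.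
      by apply: measurableU => //; exact: measurableU.
    + rewrite null_set_setU//.
      * by apply: mcol; apply: measurableU => //; exact: measurableU.
      * apply: lebesgue_rV_col'.
          by apply: measurableU => //; exact: measurableU.
        by rewrite null_set_setU// ?null_set_setU//; exact: measurableU.
    + move=> x /= H; apply: contrapT => /not_orP[Nx4 /not_orP[/not_orP[Nx1 Nx2] Nx3]].
      apply: H => Sx; have S'x : S' (col' i x).
        by move=> k; have := Sx (lift i k); rewrite !mxE.
      have W1 : W (col' i x).
        split.
          apply/eqP; rewrite -(@eqe R) -(N3P _ S'x Nx3 id)//.
          by rewrite (N1P _ S'x Nx1).
        rewrite /= -lee_fin -(N3P _ S'x Nx3 Num.norm)//; last first.
          by move=> t; rewrite normr_id.
        exact: N2P _ S'x Nx2.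
      rewrite /phi2 indicE mem_set// mulr1 /phi1 patchE mem_set//.
      exact: N4P.
rewrite /Rintegral fineK; last first.
  by apply: integrable_fin_num; [exact: measurable_open_box|
    exact: (integrable_bdd_measurable (measurable_open_box _ _) fO bphi2)].
rewrite [LHS]integral_mkcond [RHS]integral_mkcond.
apply: eq_integral => x _.
rewrite !patchE; case: ifPn => [_|xS]; case: ifPn => // xO.
- by rewrite mulrC.
- rewrite /phi2 /phi1 patchE memNset ?mul0r// => -[xO' _].
  by move/negP: xO; apply; rewrite inE.
- by move/negP: xS; case; rewrite inE; apply: OS; rewrite inE in xO.
Qed.

End coordinate.

(** * Slice envelopes and the bounds *)

Section envelope.
Context {R : realType} (n : nat) (a b : 'rV[R]_n.+1).
Hypothesis ab : forall l, a 0 l < b 0 l.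
Notation leb := (@lebesgue_measure R).
Local Open Scope ereal_scope.

Lemma lebesgue_box_gt0 d (c e : 'rV[R]_d) : (forall l, (c ord0 l < e ord0 l)%R) ->
  0 < lebesgue_box c e setT.
Proof.
move=> ce; rewrite /= /lebesgue_box /mrestr setTI.
rewrite [ltRHS](lebesgue_rV_box (fun l => ltW (ce l))) lte_fin.
by apply: prodr_gt0 => l _; rewrite subr_gt0.
Qed.

Lemma Linfty_norm_leP (phi : 'rV[R]_n.+1 -> R) (h : R) :
  Linfty_norm a b phi <= h%:E ->
  (0 <= h)%R /\ {ae lebesgue_box a b, forall x, (`|phi x| <= h)%R}.
Proof.
have box0 := lebesgue_box_gt0 ab.
rewrite /Linfty_norm unlock box0 => phih; split.
  rewrite -lee_fin; apply: le_trans phih.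
  by apply: ess_sup_gee => //; apply: nearW => x; exact: abse_ge0.
have /ess_supP := phih.
by apply: filterS => x.
Qed.

Lemma slice_le (phi : 'rV[R]_n.+1 -> R) (h : R) i :
  measurable_fun (box a b) phi -> (0 <= h)%R ->
  {ae lebesgue_box a b, forall x, (`|phi x| <= h)%R} ->
  {ae lebesgue_box (col' i a) (col' i b), forall w,
    \int[leb]_(t in `[a ord0 i, b ord0 i]) `|phi (rV_insert i t w)|%:E <=
    (h * (b ord0 i - a ord0 i))%:E}.
Proof.
move=> mphi h0 /ae_lebesgue_boxP[N [mN N0 NP]].
have [M [mM M0 MP]] := lebesgue_rV_slice_null i mN N0.
apply: (ae_lebesgue_boxI mM M0) => w wS Mw.
have leE : leb `[a ord0 i, b ord0 i]%classic = (b ord0 i - a ord0 i)%:E.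
  by rewrite lebesgue_measure_itv /= lte_fin ab.
rewrite EFinM -leE.
have insS t : `[a ord0 i, b ord0 i]%classic t -> box a b (rV_insert i t w).
  move=> tab l; case: (unliftP i l) => [k ->|->].
    by rewrite rV_insert_lift; have := wS k; rewrite !mxE.
  by rewrite rV_insert_eq; move: tab; rewrite /= in_itv.
have mins : measurable_fun setT (fun t => rV_insert i t w).
  exact: (measurableT_comp (measurable_rV_insert i) (pair2_measurable _)).
apply: (@integral_le_bound _ _ _ leb _ (fun t => (phi (rV_insert i t w))%:E) h%:E) => //.
  apply/measurable_EFinP; apply: (measurable_comp _ _ mphi).
  - exact: measurable_box.
  - by move=> _ [t tab <-]; exact: insS.
  - exact: measurable_funTS.
exists [set t | N (rV_insert i t w)]; split.
- by rewrite -[X in measurable X]setTI; exact: mins.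
- by apply: contrapT => H; apply: Mw; exact: MP.
- move=> t /= H; apply: contrapT => Nt; apply: H => tab.
  by rewrite lee_fin; apply: NP => //; exact: insS.
Qed.

Definition slice_sup (phi : 'rV[R]_n.+1 -> R) i : \bar R :=
  ess_sup (lebesgue_box (col' i a) (col' i b))
    (fun w => \int[leb]_(t in `[a ord0 i, b ord0 i]) `|phi (rV_insert i t w)|%:E).

Lemma slice_sup_le phi h i : measurable_fun (box a b) phi ->
  Linfty_norm a b phi <= h%:E -> slice_sup phi i <= (h * (b ord0 i - a ord0 i))%:E.
Proof.
move=> mphi /Linfty_norm_leP[h0 phih]; apply/ess_supP.
exact: slice_le.
Qed.

Lemma slice_sup_ge0 phi i : 0 <= slice_sup phi i.
Proof.
apply: ess_sup_gee.
  by apply: lebesgue_box_gt0 => l; rewrite !mxE.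
by apply: nearW => w; apply: integral_ge0 => t _; rewrite lee_fin.
Qed.

End envelope.

Section fin_bigmax.
Context {R : realType} {I : finType}.
Local Open Scope ereal_scope.

Lemma bigmax_fin_num (A : {set I}) (F : I -> R) : A != finset.set0 ->
  \big[maxe/-oo]_(i in A) (F i)%:E \is a fin_num.
Proof.
case/set0Pn => i iA; rewrite fin_numE; apply/andP; split.
  rewrite gt_eqF//; apply: (@lt_le_trans _ _ (F i)%:E); first exact: ltNyr.
  exact: (le_bigmax_cond _ (fun i => (F i)%:E)).
rewrite lt_eqF//; apply: (big_ind (fun x => x < +oo)) => //.
- by move=> x y; rewrite gt_max => -> ->.
- by move=> j _; exact: ltry.
Qed.

End fin_bigmax.

Section finiteness.
Context {R : realType} (n : nat) (a b : 'rV[R]_n.+1).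
Hypothesis ab : forall l, a ord0 l < b ord0 l.
Variables (f phi : 'rV[R]_n.+1 -> R) (i : 'I_n.+1).
Local Open Scope ereal_scope.

Lemma Linfty_norm_fin_num : Linfty a b phi -> Linfty_norm a b phi \is a fin_num.
Proof. by case=> _ phioo; rewrite ge0_fin_numE//; exact: Lnorm_ge0. Qed.

Lemma slice_sup_fin_num : Linfty a b phi -> slice_sup a b phi i \is a fin_num.
Proof.
move=> Lphi; have [mphi _] := Lphi.
rewrite ge0_fin_numE; last exact: slice_sup_ge0.
apply: (le_lt_trans (slice_sup_le ab (h := fine (Linfty_norm a b phi)) i mphi _)).
  by rewrite fineK// Linfty_norm_fin_num.
exact: ltry.
Qed.

Let variation_fin_num (nu : {charge set 'rV[R]_n.+1 -> \bar R}) :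
  Defs.variation nu (box a b)° \is a fin_num.
Proof.
by rewrite /Defs.variation fin_numD; apply/andP; split; apply: fin_num_measure;
  rewrite interior_box; exact: measurable_open_box.
Qed.

Let variation_ge0 (nu : {charge set 'rV[R]_n.+1 -> \bar R}) A : 0 <= Defs.variation nu A.
Proof. by apply: adde_ge0. Qed.

Lemma partial_variation_fin_num : BV a b f -> partial_variation a b i f \is a fin_num.
Proof.
move=> [_ Df]; rewrite /partial_variation; case: pselect => [ex|]; last by move: (Df i).
exact: variation_fin_num.
Qed.

Lemma partial_variation_ge0 : 0 <= partial_variation a b i f.
Proof.
by rewrite /partial_variation; case: pselect => // ex; exact: variation_ge0.
Qed.

Lemma coordinatewise_bound : BV a b f -> Linfty a b phi ->
  {ae lebesgue_box (col' i a) (col' i b), forall w,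
    \int[lebesgue_measure]_(t in `[a ord0 i, b ord0 i]) (phi (rV_insert i t w))%:E = 0} ->
  `|expectation_density a b f phi| <=
    (fine (slice_sup a b phi i) / 2 * fine (partial_variation a b i f))%:E.
Proof.
move=> BVf Lphi cent; have [mphi _] := Lphi; have [fi Df] := BVf.
have phih := Linfty_norm_leP ab (h := fine (Linfty_norm a b phi)).
rewrite fineK ?Linfty_norm_fin_num// in phih.
have {phih}[h0 phih] := phih phi (lexx _).
rewrite EFinM fineK ?partial_variation_fin_num// /partial_variation.
case: pselect => [ex|]; last by move: (Df i).
apply: (coordinate_bound ab mphi phih fi (svalP (cid ex)) _ cent).
  exact/fine_ge0/slice_sup_ge0.
have := ess_sup_ge (lebesgue_box (col' i a) (col' i b))
  (fun w => \int[lebesgue_measure]_(t in `[a ord0 i, b ord0 i]) `|phi (rV_insert i t w)|%:E).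
by rewrite -/(slice_sup a b phi i) fineK ?slice_sup_fin_num.
Qed.

End finiteness.

Local Open Scope ereal_scope.

Theorem theorem2p6 (R : realType) (d : nat) (hd : (0 < d)%N)
    (a b : 'rV[R]_d) (hab : forall i : 'I_d, (a ord0 i < b ord0 i)%R)
    (I : {set 'I_d}) (hI : I != finset.set0)
    (f phi : 'rV[R]_d -> R)
    (hf : BV a b f) (hdens : probability_density a b f)
    (hphi : W1infty a b phi) (hcent : centered_on a b I phi) :
  [/\ `|expectation_density a b f phi| <=
        ((2 * #|I|%:R)^-1)%:E * slice_envelope a b I phi * TV a b I f,
      `|expectation_density a b f phi| <=
        ((2 * #|I|%:R)^-1)%:E * slice_envelope a b I phi * TV_infty a b f &
      forall h : R, Linfty_norm a b phi <= h%:E ->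
        `|expectation_density a b f phi| <=
          (h / (2 * #|I|%:R))%:E *
          (\big[maxe/-oo]_(i in I) (b ord0 i - a ord0 i)%:E) * TV a b I f].
Proof.
case: d => [//|n] in hd a b hab I hI f phi hf hdens hphi hcent *.
have [Lphi _] := hphi; have [mphi _] := Lphi.
have k0 : (0 < #|I|%:R :> R)%R by rewrite ltr0n card_gt0.
pose c i := fine (slice_sup a b phi i).
pose v i := fine (partial_variation a b i f).
have cE i : slice_sup a b phi i = (c i)%:E by rewrite fineK// slice_sup_fin_num.
have vE i : partial_variation a b i f = (v i)%:E.
  by rewrite fineK// partial_variation_fin_num.
have c0 i : (0 <= c i)%R by apply/fine_ge0/slice_sup_ge0.
have v0 i : (0 <= v i)%R by apply/fine_ge0/partial_variation_ge0.
have bnd i : i \in I -> `|expectation_density a b f phi| <= (c i / 2 * v i)%:E.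
  by move=> iI; apply: coordinatewise_bound => //; exact: hcent.
have envE : slice_envelope a b I phi = \big[maxe/-oo]_(i in I) (c i)%:E.
  by apply: eq_bigr => i _; exact: cE.
have [l lE] : exists l : R, slice_envelope a b I phi = l%:E.
  by exists (fine (slice_envelope a b I phi)); rewrite fineK// envE bigmax_fin_num.
have cl i : i \in I -> (c i <= l)%R.
  by move=> iI; rewrite -lee_fin -lE envE; exact: (le_bigmax_cond _ (fun i => (c i)%:E)).
have /set0Pn[i0 i0I] := hI.
have l0 : (0 <= l)%R by exact: le_trans (c0 i0) (cl _ i0I).
have TVE : TV a b I f = (\sum_(i in I) v i)%:E.
  by rewrite -sumEFin; apply: eq_bigr => i _; exact: vE.
have TV0 : (0 <= \sum_(i in I) v i)%R by exact: sumr_ge0.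
have [r rE] : exists r : R, `|expectation_density a b f phi| = r%:E.
  exists (fine `|expectation_density a b f phi|); rewrite fineK//.
  by rewrite ge0_fin_numE// (le_lt_trans (bnd _ i0I))// ltry.
(* Summing the [k] coordinatewise bounds and dividing by [k]. *)
have key : (r <= (2 * #|I|%:R)^-1 * l * \sum_(i in I) v i)%R.
  have : (#|I|%:R * r <= l / 2 * \sum_(i in I) v i)%R.
    rewrite mulr_natl -sumr_const mulr_sumr; apply: ler_sum => i iI.
    apply: (@le_trans _ _ (c i / 2 * v i)%R).
      by rewrite -lee_fin -rE; exact: bnd.
    by rewrite ler_wpM2r// ler_wpM2r// cl.
  rewrite mulrC -ler_pdivlMr// => /le_trans; apply.
  by rewrite le_eqVlt; apply/orP; left; apply/eqP; field; rewrite gt_eqF.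
have key1 : `|expectation_density a b f phi| <=
    ((2 * #|I|%:R)^-1)%:E * slice_envelope a b I phi * TV a b I f.
  by rewrite rE lE TVE -!EFinM lee_fin.
have coef0 : (0 <= (2 * #|I|%:R)^-1 :> R)%R by rewrite invr_ge0 mulr_ge0// ltW.
split => // [|h phih].
- apply: (le_trans key1); rewrite lee_wpmul2l//.
    by rewrite lE -EFinM lee_fin mulr_ge0.
  rewrite /TV /TV_infty [leRHS](bigID (mem I))/= leeDl//.
  by apply: sume_ge0 => i _; rewrite vE lee_fin.
- have [h0 _] := Linfty_norm_leP hab phih.
  have mfin : \big[maxe/-oo]_(i in I) (b ord0 i - a ord0 i)%:E \is a fin_num.
    exact: bigmax_fin_num.
  rewrite -(fineK mfin); set m := fine _.
  have lhm : (l <= h * m)%R.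
    rewrite -lee_fin -lE; apply: bigmax_le => [|i iI]; first exact: leNye.
    apply: le_trans (slice_sup_le hab i mphi phih) _.
    rewrite lee_fin ler_wpM2l// -lee_fin fineK//.
    exact: (le_bigmax_cond _ (fun i => (b ord0 i - a ord0 i)%:E)).
  apply: (le_trans key1); rewrite lE TVE -!EFinM lee_fin ler_wpM2r//.
  by rewrite [leRHS]mulrAC mulrC ler_wpM2r.
Qed.
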